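(* For any $1<p<\infty$, the family $\widetilde{\mathscr{T}}=\{T_k: k\in\widetilde{\mathscr{K}}\}$ fails to be $\ell^1$-bounded on $L^p(\mathbb{R}_+;\ell^1(\ell^2))$. As a consequence, for any $2<p<\infty$ and any non-zero Hilbert space $H$, the family $\{S^H_k: k^2\in\widetilde{\mathscr{K}}\}$ fails to be $R$-bounded from $L^p_{\mathscr{F}}(\mathbb{R}_+\times\Omega;\gamma(H,\ell^2(\ell^4)))$ to $L^p(\mathbb{R}_+\times\Omega;\ell^2(\ell^4))$.
   Context: All vector spaces are real. $\ell^p(\ell^q)$ is the space of $\ell^p$-sequences with values in $\ell^q$, a Banach lattice for the coordinatewise order. $\widetilde{\mathscr{K}}$ is the set of all $k\in L^1(\mathbb{R})$ such that $|k*f|\le\widetilde M|f|$ almost everywhere for all simple $f:\mathbb{R}\to\mathbb{R}$, where $\widetilde Mf(\xi)=\sup_{r>0}\frac1{2r}\int_{\xi-r}^{\xi+r}|f(\eta)|\,d\eta$. When working on $\mathbb{R}_+$, functions and kernels are taken to be supported on $\mathbb{R}_+$, i.e. kernels on $\mathbb{R}_+$ are extended by $0$ to $\mathbb{R}$ and belong to $\widetilde{\mathscr{K}}$ if their extensions do; $T_kf(t)=\int_0^tk(t-s)f(s)\,ds$. In the second part $k$ ranges over the functions in $L^2(\mathbb{R}_+)$ with $k^2\in\widetilde{\mathscr{K}}$. A family $\mathscr{T}$ of bounded operators on a Banach lattice $E$ is $\ell^1$-bounded if there is $C\ge0$ with $\|\sum_{n=1}^N|T_nx_n|\|\le C\|\sum_{n=1}^N|x_n|\|$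 for all finite sequences $T_n\in\mathscr{T}$, $x_n\in E$. A family $\mathscr{T}$ of bounded operators between Banach spaces $E$ and $F$ is $R$-bounded if there is $C\ge0$ with $\mathbb{E}\|\sum_{n=1}^N r_nT_nx_n\|^2\le C^2\,\mathbb{E}\|\sum_{n=1}^N r_nx_n\|^2$ for all finite sequences $T_n\in\mathscr{T}$, $x_n\in E$, where $(r_n)$ is a Rademacher sequence (independent, uniform in $\{-1,1\}$). For a Banach space $X$, $\gamma(H,X)$ is the completion of the finite rank operators from $H$ to $X$ in the norm $\|\sum_{n=1}^N h_n\otimes x_n\|_{\gamma(H,X)}^2=\mathbb{E}\|\sum_{n=1}^N\gamma_nx_n\|^2$ ($h_n$ orthonormal in $H$, $x_n\in X$, $(\gamma_n)$ independent standard Gaussians). $(\Omega,\mathbb{P})$ is a probability space with filtration $\mathscr{F}=(\mathscr{F}_t)_{t\ge0}$ and $W_H$ is an $H$-cylindrical $\mathscr{F}$-Brownian motion: a bounded operator $W_H:L^2(\mathbb{R}_+;H)\to L^2(\Omega)$ such that each $W_Hf$ is centred Gaussian, $\mathbb{E}(W_Hf\cdot W_Hg)=[f,g]$, and $W_Hf$ is independent of $\mathscr{F}_t$ if $f$ is supported in $(t,\infty)$. Adapted finite rank step processes are finite linear combinations of $\mathbf{1}_{(a,b]\times A}\otimes(h\otimes x)$, $0\le a<b<\infty$, $A\in\mathscr{F}_a$, $h\in H$, $x\in X$, with $\int_0^t\mathbf{1}_{(a,b]\times A}\otimes(h\otimes x)\,dW_H=\mathbf{1}_A\,W_H(\mathbf{1}_{(a\wedge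 t,b\wedge t]}\otimes h)\otimes x$, extended by linearity; stochastic integrals of more general integrands are defined by the usual density extension. $L^p_{\mathscr{F}}(\mathbb{R}_+\times\Omega;\gamma(H,X))$ is the subspace of adapted elements of $L^p(\mathbb{R}_+\times\Omega;\gamma(H,X))$ (the closure of the adapted finite rank step processes). $S^H_k$ is the (bounded extension of the) operator $S^H_kG(t)=\int_0^tk(t-s)G(s)\,dW_H(s)$, $t\in\mathbb{R}_+$, initially defined on adapted finite rank step processes $G$. *)

(* Defs.v *)
From HB Require Import structures.
From mathcomp Require Import all_boot all_order all_algebra.
From mathcomp Require Import all_classical all_reals all_analysis.

Set Implicit Arguments.
Unset Strict Implicit.
Unset Printing Implicit Defensive.

Import Order.TTheory GRing.Theory Num.Theory.
Import numFieldNormedType.Exports HBSimple.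

Local Open Scope classical_set_scope.
Local Open Scope ring_scope.
Local Open Scope ereal_scope.

(* A Banach space is represented by a vector space [V] together with an
   extended norm [N : V -> \bar R]: its elements are the [v] with
   [N v < +oo].  Elements of an L^p space are represented by functions, which
   are identified when they agree almost everywhere. *)

Section bochner_spaces.
Context {R : realType} {V : lmodType R} (N : V -> \bar R).
Context {d} {T : measurableType d} (mu : {measure set T -> \bar R}).

Definition simple_fun (s : T -> V) : Prop :=
  [/\ finite_set (range s),
      forall v, measurable (s @^-1` [set v]) &
      forall t, N (s t) < +oo].

Definition strongly_measurable (f : T -> V) : Prop :=
  exists s : nat -> T -> V, (forall m, simple_fun (s m)) /\
    {ae mu, forall t, N (s m t - f t)%R @[m --> \oo] --> 0}.

Definition Lp_norm (p : R) (f : T -> V) : \bar R :=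
  'N[mu]_(p%:E)[N \o f].

Definition Lp_space (p : R) : set (T -> V) :=
  [set f | strongly_measurable f /\ Lp_norm p f < +oo].

End bochner_spaces.

Section boundedness_notions.
Context {R : realType}.

Definition ell1_bounded {V : lmodType R} (E : set V) (N : V -> \bar R)
    (absV : V -> V) (family : set (V -> V)) : Prop :=
  exists2 C : R, (0 <= C)%R &
    forall (n : nat) (T : 'I_n -> V -> V) (x : 'I_n -> V),
      (forall i, family (T i)) -> (forall i, E (x i)) ->
      N (\sum_(i < n) absV (T i (x i)))%R
        <= C%:E * N (\sum_(i < n) absV (x i))%R.

(* Expectation with respect to n independent random variables that are
   uniform in {-1, 1}: the average over all sign vectors. *)
Definition rademacherE (n : nat) (F : ('I_n -> R) -> \bar R) : \bar R :=
  ((2 ^+ n)^-1)%R%:E *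
    \sum_(e : {ffun 'I_n -> bool}) F (fun i => ((-1) ^+ e i)%R).

(* Operators from [V] to [W] are given by their graphs, and [x] belongs to the
   domain of [T] when [T x y] holds for some [y]; this accommodates operators
   that are defined as bounded extensions and up to almost everywhere
   equality. *)
Definition R_bounded {V W : lmodType R} (NV : V -> \bar R) (NW : W -> \bar R)
    (family : set (V -> W -> Prop)) : Prop :=
  exists2 C : R, (0 <= C)%R &
    forall (n : nat) (T : 'I_n -> V -> W -> Prop)
      (x : 'I_n -> V) (y : 'I_n -> W),
      (forall i, family (T i)) -> (forall i, T i (x i) (y i)) ->
      rademacherE (fun r : 'I_n -> R => NW (\sum_(i < n) r i *: y i)%R ^+ 2)
        <= (C ^+ 2)%R%:E *
      rademacherE (fun r : 'I_n -> R => NV (\sum_(i < n) r i *: x i)%R ^+ 2).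

End boundedness_notions.

Section kernels.
Context {R : realType}.
Local Notation leb := (@lebesgue_measure R).

(* Lebesgue measure on an interval, e.g. on [0, +oo[, as a measure on R. *)
Definition leb_on (i : interval R) : {measure set (measurableTypeR R) -> \bar R} :=
  mrestr leb (measurable_itv i).

Definition leb_plus : {measure set (measurableTypeR R) -> \bar R} := leb_on `[0%R, +oo[.

Definition convolution (k f : R -> R) (xi : R) : R :=
  (\int[leb]_eta (k (xi - eta) * f eta))%R.

Definition Ktilde : set (R -> R) :=
  [set k | leb.-integrable setT (EFin \o k) /\
    forall f : {sfun measurableTypeR R >-> R},
      {ae leb, forall xi, `|convolution k f xi|%R%:E <= HL_maximal f xi}].

Definition supported_on_plus (k : R -> R) : Prop :=
  forall t, (t < 0)%R -> k t = 0%R.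

Definition Ktilde_plus : set (R -> R) :=
  [set k | supported_on_plus k /\ Ktilde k].

Definition sqrt_Ktilde_plus : set (R -> R) :=
  [set k | [/\ supported_on_plus k,
               (k : measurableTypeR R -> R) \in Lfun leb 2%:E &
               Ktilde (fun t => k t ^+ 2)%R]].

End kernels.

Section sequence_spaces.
Context {R : realType}.

Definition seq2 : Type := nat -> nat -> R.
HB.instance Definition _ := GRing.Lmodule.on seq2.

(* The norm of l^p(l^q); [x i j] is the j-th coordinate of the i-th term. *)
Definition lplq_norm (p q : R) (x : seq2) : \bar R :=
  Lnorm counting p%:E (fun i => 'N[counting]_(q%:E)[EFin \o x i]).

Definition abs_fun {T : Type} (f : T -> seq2) : T -> seq2 :=
  fun t i j => `|f t i j|%R.

(* The Bochner integral in l^p(l^q) is computed coordinatewise. *)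
Definition Tconv (k : R -> R) (f : R -> seq2) : R -> seq2 :=
  fun t i j =>
    (\int[lebesgue_measure]_(s in `[0%R, t]) (k (t - s) * f s i j))%R.

End sequence_spaces.
Arguments seq2 : clear implicits.

Section hilbert.
Context {R : realType} {H : completeNormedModType R} (ip : H -> H -> R).

Definition is_inner_product : Prop :=
  [/\ forall (a : R) (x y z : H), (ip (a *: x + y) z = a * ip x z + ip y z)%R,
      forall x y : H, ip x y = ip y x &
      forall x : H, (`|x| ^+ 2 = ip x x)%R].

Definition hilbert_norm (x : H) : \bar R := `|x|%R%:E.

Definition orthonormal (n : nat) (h : 'I_n -> H) : Prop :=
  forall i j, ip (h i) (h j) = ((i == j)%:R)%R.

Section gamma_radonifying.
Context {X : lmodType R} (NX : X -> \bar R).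

(* h (x) x : g |-> [g, h] x *)
Definition finite_rank (n : nat) (h : 'I_n -> H) (x : 'I_n -> X) : H -> X :=
  fun g => (\sum_(i < n) ip g (h i) *: x i)%R.

(* Expectation with respect to n independent standard Gaussians, i.e. the
   iterated integral for the n-fold product of the standard normal law. *)
Fixpoint gaussianE (n : nat) (F : seq R -> \bar R) : \bar R :=
  match n with
  | 0%N => F [::]
  | n'.+1 => \int[normal_prob 0%R 1%R]_z gaussianE n' (fun g => F (z :: g))
  end.

(* The gamma-norm of a finite rank operator.  All elements of the set below
   are equal, so the infimum only selects this common value; the set is empty
   and the value is +oo for operators that are not of finite rank. *)
Definition gamma_norm_fin (u : H -> X) : \bar R :=
  ereal_inf [set v | exists n (h : 'I_n -> H) (x : 'I_n -> X),
    [/\ orthonormal h, forall i, NX (x i) < +oo, u = finite_rank h x &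
        v = gaussianE n (fun g => NX (\sum_(i < n) g`_i *: x i)%R ^+ 2)
              `^ (2^-1)%R]].

(* gamma(H, X), the completion of the finite rank operators, is realised inside
   the operators from H to X: its elements are the pointwise limits [u] of
   sequences [r] of finite rank operators that are Cauchy for the gamma-norm,
   with norm the limit of the norms, which does not depend on [r].  The value
   is +oo if [u] is not in gamma(H, X). *)
Definition gamma_norm (u : H -> X) : \bar R :=
  ereal_inf [set l | exists r : nat -> H -> X,
    [/\ forall m, gamma_norm_fin (r m) < +oo,
        forall e : R, (0 < e)%R -> exists M, forall m n,
          (M <= m)%N -> (M <= n)%N -> gamma_norm_fin (r m - r n)%R < e%:E,
        forall g, NX (r m g - u g)%R @[m --> \oo] --> 0 &
        gamma_norm_fin (r m) @[m --> \oo] --> l]].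

End gamma_radonifying.

Section stochastic_integration.
Context {d} {Omega : measurableType d} (P : probability Omega R).

Definition is_filtration (F : R -> set (set Omega)) : Prop :=
  (forall t, (0 <= t)%R ->
     sigma_algebra setT (F t) /\ F t `<=` measurable) /\
  (forall s t, (0 <= s)%R -> (s <= t)%R -> F s `<=` F t).

(* The law of [Z] is N(0, s^2); for s = 0 it is the Dirac mass at 0. *)
Definition centred_gaussian (Z : Omega -> R) : Prop :=
  measurable_fun setT Z /\
  exists2 s : R, (0 <= s)%R &
    if s == 0%R then {ae P, forall w, Z w = 0%R}
    else forall B : set R, measurable B ->
           P (Z @^-1` B) = normal_prob 0%R s B.

Definition independent_of (Z : Omega -> R) (G : set (set Omega)) : Prop :=
  forall (A : set Omega) (B : set R), G A -> measurable B ->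
    P (A `&` Z @^-1` B) = P A * P (Z @^-1` B).

Definition L2H : set (R -> H) := Lp_space hilbert_norm leb_plus 2%R.

(* The H-cylindrical F-Brownian motions, as operators from L^2(R_+; H) to
   L^2(Omega). *)
Definition is_cylindrical_BM (F : R -> set (set Omega))
    (W : (R -> H) -> Omega -> R) : Prop :=
  [/\ [/\ forall f, L2H f -> W f \in Lfun P 2%:E,
      forall (a : R) f g, L2H f -> L2H g ->
        {ae P, forall w, W (a *: f + g)%R w = (a * W f w + W g w)%R} &
      exists2 C : R, (0 <= C)%R & forall f, L2H f ->
        'N[P]_(2%:E)[EFin \o W f] <= C%:E * Lp_norm hilbert_norm leb_plus 2%R f],
      forall f, L2H f -> centred_gaussian (W f),
      forall f g, L2H f -> L2H g ->
        'E_P[(W f \* W g)%R] = \int[leb_plus]_t (ip (f t) (g t))%:E &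
      forall t f, (0 <= t)%R -> L2H f -> (forall s, (s <= t)%R -> f s = 0%R) ->
        independent_of (W f) (F t)].

Context {X : lmodType R} (NX : X -> \bar R).
Variables (F : R -> set (set Omega)) (W : (R -> H) -> Omega -> R).

(* The data of 1_{]a, b] x A} (x) (h (x) x); an adapted finite rank step
   process is given by a finite list of these. *)
Record elementary := Elementary {
  el_a : R ; el_b : R ; el_A : set Omega ; el_h : H ; el_x : X }.

Definition adapted_elementary (e : elementary) : Prop :=
  [/\ (0 <= el_a e)%R, (el_a e < el_b e)%R, F (el_a e) (el_A e) &
      NX (el_x e) < +oo].

Definition adapted_step (G : seq elementary) : Prop :=
  forall i, (i < size G)%N ->
    adapted_elementary (nth (Elementary 0 0 set0 0 0)%R G i).

Definition step_process (G : seq elementary) : R * Omega -> H -> X :=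
  fun z g => (\sum_(e <- G)
    (\1_(`]el_a e, el_b e]) z.1 * \1_(el_A e) z.2 * ip g (el_h e)) *: el_x e)%R.

Definition step_integral (G : seq elementary) (t : R) : Omega -> X :=
  fun w => (\sum_(e <- G) (\1_(el_A e) w *
    W (fun s => \1_(`]Num.min (el_a e) t, Num.min (el_b e) t]) s *: el_h e) w)
      *: el_x e)%R.

Local Notation gammaN := (gamma_norm NX).

(* [I] is the stochastic integral of [Phi] over (0, t), where
   Phi is in L^2((0, t) x Omega; gamma(H, X)): it is the L^2-limit of the
   integrals of adapted finite rank step processes that converge to [Phi]. *)
Definition stochastic_integral (t : R) (Phi : R * Omega -> H -> X)
    (I : Omega -> X) : Prop :=
  [/\ Lp_space gammaN (leb_on `[0%R, t] \x P) 2%R Phi,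
      Lp_space NX P 2%R I &
      exists G : nat -> seq elementary, [/\ forall m, adapted_step (G m),
        Lp_norm gammaN (leb_on `[0%R, t] \x P) 2%R
          (step_process (G m) - Phi)%R @[m --> \oo] --> 0 &
        Lp_norm NX P 2%R (step_integral (G m) t - I)%R @[m --> \oo] --> 0]].

Definition LpF_norm (p : R) : (R * Omega -> H -> X) -> \bar R :=
  Lp_norm gammaN (leb_plus \x P) p.

Definition LpX_norm (p : R) : (R * Omega -> X) -> \bar R :=
  Lp_norm NX (leb_plus \x P) p.

Definition approximates (p : R) (G : nat -> seq elementary)
    (Phi : R * Omega -> H -> X) : Prop :=
  (forall m, adapted_step (G m)) /\
  LpF_norm p (step_process (G m) - Phi)%R @[m --> \oo] --> 0.

Definition LpF (p : R) : set (R * Omega -> H -> X) :=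
  [set Phi | Lp_space gammaN (leb_plus \x P) p Phi /\
    exists G, approximates p G Phi].

Definition LpX (p : R) : set (R * Omega -> X) :=
  Lp_space NX (leb_plus \x P) p.

(* Y(t) is the integral over (0, t) of k(t - s) G(s) dW(s), for almost all t. *)
Definition stoch_conv_step (k : R -> R) (p : R) (G : seq elementary)
    (Y : R * Omega -> X) : Prop :=
  LpX p Y /\
  {ae leb_plus, forall t, stochastic_integral t
     (fun z => k (t - z.1)%R *: step_process G z)%R (fun w => Y (t, w))}.

(* The graph of the bounded extension of the stochastic convolution operator
   to [LpF p], as the closure of its graph on adapted step processes. *)
Definition stoch_conv (k : R -> R) (p : R)
    (Phi : R * Omega -> H -> X) (Y : R * Omega -> X) : Prop :=
  [/\ LpF p Phi, LpX p Y &
      exists (G : nat -> seq elementary) (Z : nat -> R * Omega -> X),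
        [/\ approximates p G Phi,
            forall m, stoch_conv_step k p (G m) (Z m) &
            LpX_norm p (Z m - Y)%R @[m --> \oo] --> 0]].

End stochastic_integration.
End hilbert.

(* Main.v *)
Require Import Defs.
From HB Require Import structures.
From mathcomp Require Import all_boot all_order all_algebra.
From mathcomp Require Import all_classical all_reals all_analysis.
From mathcomp Require Import measurable_realfun zify lra.

Set Implicit Arguments.
Unset Strict Implicit.
Unset Printing Implicit Defensive.

Import Order.TTheory GRing.Theory Num.Theory.
Import numFieldNormedType.Exports HBSimple.

(** Both parts come from one computation on the line.  Fix [J], put [M = 2 ^ J]
    and, for [j < J], let [x_j] be the function whose coordinate [(i, j)] is the
    indicator of the cell (i, i + 1], for [i < 2 * M], all its other
    coordinates being zero.  Let [T_j] be the convolution with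
    [box_kernel (2 ^ (j + 1))], that is, half of the mean over the preceding
    [2 ^ (j + 1)] units of time; it is dominated by the maximal function
    ([Ktilde_box_kernel]).

    At a time in (0, 2 * M] a single row [i] of [sum_j |x_j|] is non-zero, and
    it consists of [J] ones, so the norm in l^1(l^2) is [sqrt J].  On the other
    hand, if [2 ^ j < t - i <= 2 ^ (j + 1)], then the cell [i] lies entirely in
    the window of [T_j] at time [t], and the entry [(i, j)] of [T_j x_j] at [t]
    is [2 ^- (j + 2)].  For [t] in (M, 2 * M] every scale [j] suits exactly
    [2 ^ j] rows, and no row suits two scales; keeping one entry per row, the
    norm of [sum_j |T_j x_j|] is at least
    [sum_j 2 ^ j * 2 ^- (j + 2) = J / 4] ([sum_dyadic_ge],
    [lplq_norm_ge_selection]).  The sets (0, 2 * M] and (M, 2 * M] have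
    comparable measure, so an l^1-bound [C] would give [J <= c * C * sqrt J] for
    every [J].

    For the stochastic convolutions take square roots: [k_j ^ 2] is the box
    kernel and [G_j = x_j (x) h] with a unit vector [h].  As the [G_j] live on
    disjoint coordinates and the norms only see absolute values, the signs in
    the Rademacher averages have no influence on the norms.  The space l^2(l^4) is the
    2-convexification of l^1(l^2): the input has norm at most a constant times
    [J ^ (1 / 4)] ([inputs_norm_le]), whereas the mean square of the norm of the
    output is at least [sum_(i, j) E |S_j G_j(t)_(i, j)| ^ 2] over the selected
    entries, whose variances are the numbers [2 ^- (j + 2)] of the first part
    ([integral_selected_energy_ge]).  For [p > 2] a large mean square forces a
    large p-norm ([Lnorm_ge_mean]), and the squares of the two norms again
    differ by a factor of order [sqrt J].

    To exhibit the output as an element of L^p one needs a jointly measurable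
    version of t |-> W (1_(0, t] h): its increments over the dyadic grid
    are so small in L^2 that they converge almost surely for each fixed [t]
    ([dyadic_limit_ae]), and the convolution is a difference of two values of
    this version at clamped times ([indic_clamp]).  Its p-norm is finite because
    Gaussian moments are controlled by the variance ([gaussian_moment],
    [normal_sd_le3]). *)

Local Open Scope classical_set_scope.
Local Open Scope ring_scope.

(** * Norms of finitely supported double sequences *)

Section sequence_norms.
Context {R : realType}.

Lemma nneseries_finite_support (f : nat -> \bar R) n :
  (forall k, (n <= k)%N -> f k = 0%E) ->
  (\sum_(k <oo) f k = \sum_(k < n) f k)%E.
Proof.
move=> f0; apply: lim_near_cst; first exact: ereal_hausdorff.
near=> m; rewrite /= -(big_mkord xpredT f).
have nm : (n <= m)%N by near: m; exact: nbhs_infty_ge.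
rewrite (@big_cat_nat _ _ _ n)//= -[RHS]adde0; congr (_ + _)%E.
by rewrite big_nat big1// => k /andP[nk _]; exact: f0.
Unshelve. all: by end_near. Qed.

Lemma lplq_norm_finite_support (p q : R) n m (x : seq2 R) :
  0 < p -> 0 < q -> (forall i j, ~~ ((i < n) && (j < m))%N -> x i j = 0) ->
  lplq_norm p q x = ((\sum_(i < n) (\sum_(j < m) `|x i j| `^ q) `^ (p / q))
                      `^ p^-1)%:E.
Proof.
move=> p0 q0 x0; rewrite /lplq_norm Lnorm_counting//.
under eq_eseriesr => i _.
  rewrite Lnorm_counting// (@nneseries_finite_support _ m); last first.
    move=> j mj /=; rewrite x0 ?normr0 ?powR0 ?gt_eqF//.
    by rewrite negb_and -!leqNgt mj orbT.
  rewrite /= sumEFin /= ger0_norm ?powR_ge0// -powRrM mulrC.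
  over.
rewrite (@nneseries_finite_support _ n); last first.
  move=> i ni; rewrite big1 ?powR0 ?gt_eqF ?divr_gt0// => j _.
  rewrite x0 ?normr0 ?powR0 ?gt_eqF//.
  by rewrite negb_and -!leqNgt ni.
by rewrite sumEFin.
Qed.

(** The l^p norm is at most the l^1 norm: with [S] the sum of the entries,
    [a_i ^ p <= a_i * S ^ (p - 1)]. *)
Lemma powR_sum_le n (a : 'I_n -> R) (p : R) :
  1 <= p -> (forall i, 0 <= a i) ->
  (\sum_(i < n) a i `^ p) `^ p^-1 <= \sum_(i < n) a i.
Proof.
move=> p1 a0; have p0 : 0 < p by rewrite (lt_le_trans _ p1).
have S0 : 0 <= \sum_(i < n) a i by apply: sumr_ge0.
rewrite -[leRHS]powRr1// -(@mulfV _ p) ?gt_eqF// powRrM.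
apply: ge0_ler_powR; rewrite ?nnegrE ?invr_ge0 ?powR_ge0 ?(ltW p0)//.
  by apply: sumr_ge0 => i _; exact: powR_ge0.
rewrite -[leRHS]mulr_powRB1// mulr_suml; apply: ler_sum => i _.
rewrite -mulr_powRB1//; apply: ler_wpM2l => //.
apply: ge0_ler_powR; rewrite ?nnegrE ?subr_ge0//.
by rewrite (bigD1 i)//= lerDl sumr_ge0.
Qed.

Lemma lplq_norm_le_sum (p q : R) n m (x : seq2 R) :
  1 <= p -> 1 <= q -> (forall i j, ~~ ((i < n) && (j < m))%N -> x i j = 0) ->
  (lplq_norm p q x <= (\sum_(i < n) \sum_(j < m) `|x i j|)%:E)%E.
Proof.
move=> p1 q1 x0; have p0 : 0 < p by rewrite (lt_le_trans _ p1).
have q0 : 0 < q by rewrite (lt_le_trans _ q1).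
rewrite (lplq_norm_finite_support p0 q0 x0) lee_fin.
under eq_bigr do rewrite mulrC powRrM.
apply: le_trans (powR_sum_le _ _) _ => //; first by move=> i; exact: powR_ge0.
by apply: ler_sum => i _; exact: powR_sum_le.
Qed.

Lemma lplq_norm_ge0 (p q : R) (x : seq2 R) : (0 <= lplq_norm p q x)%E.
Proof. exact: Lnorm_ge0. Qed.

Lemma lplq_norm0 (p q : R) : 0 < p -> 0 < q -> lplq_norm p q (0 : seq2 R) = 0%E.
Proof.
move=> p0 q0; rewrite (@lplq_norm_finite_support p q 0 0)//.
by rewrite big_ord0 powR0// invr_eq0 gt_eqF.
Qed.

(** The inner norm dominates any single entry, so that one entry may be kept
    in every row. *)
Lemma lplq_norm_ge_selection (p q : R) n m (x : seq2 R)
    (chi : nat -> nat -> bool) :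
  0 < p -> 0 < q -> (forall i j, ~~ ((i < n) && (j < m))%N -> x i j = 0) ->
  (forall i j j', chi i j -> chi i j' -> j = j') ->
  ((\sum_(i < n) \sum_(j < m) (chi i j)%:R * `|x i j| `^ p)%:E
    <= lplq_norm p q x `^ p)%E.
Proof.
move=> p0 q0 x0 chi1; rewrite (lplq_norm_finite_support p0 q0 x0).
rewrite poweR_EFin lee_fin -powRrM mulVf ?gt_eqF// powRr1; last first.
  by apply: sumr_ge0 => i _; exact: powR_ge0.
apply: ler_sum => i _.
have [/existsP[j cj]|] := boolP [exists j : 'I_m, chi i j]; last first.
  rewrite negb_exists => /forallP h; rewrite big1 ?powR_ge0// => j _.
  by rewrite (negbTE (h j)) mul0r.
rewrite (bigD1 j)//= cj mul1r big1 ?addr0 => [|j' jj']; last first.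
  case: (boolP (chi i j')) => [cj'|_]; last by rewrite mul0r.
  by move: jj'; rewrite -val_eqE /= (chi1 _ _ _ cj' cj) eqxx.
have pE : p = q * (p / q) by rewrite mulrCA mulfV ?mulr1 ?gt_eqF.
rewrite {1}pE powRrM.
apply: ge0_ler_powR; rewrite ?nnegrE ?powR_ge0 ?divr_ge0 ?(ltW p0) ?(ltW q0)//.
  by apply: sumr_ge0 => ? _; exact: powR_ge0.
by rewrite (bigD1 j)//= lerDl sumr_ge0// => ? _; exact: powR_ge0.
Qed.

Lemma lplq_norm_signs (p q : R) i0 m (x : seq2 R) :
  0 < p -> 0 < q ->
  (forall i j, `|x i j| = ((i == i0) && (j < m)%N)%:R) ->
  lplq_norm p q x = (m%:R `^ q^-1)%:E.
Proof.
move=> p0 q0 xE; rewrite (@lplq_norm_finite_support p q i0.+1 m)//; last first.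
  move=> i j ij; apply/eqP; rewrite -normr_eq0 xE; move: ij.
  by case: (i =P i0) => [->|_ _]; rewrite ?ltnSn ?andFb /= ?eqxx// => /negbTE ->.
rewrite big_ord_recr/= big1 ?add0r => [|i _]; last first.
  rewrite big1 ?powR0 ?gt_eqF ?divr_gt0// => j _.
  by rewrite xE ltn_eqF ?powR0 ?gt_eqF// ltn_ord.
rewrite (eq_bigr (fun=> 1)) => [|j _]; last by rewrite xE eqxx ltn_ord powR1.
rewrite sumr_const card_ord -powRrM.
by congr ((_ `^ _)%:E); rewrite mulrC mulrA mulVf ?mul1r ?gt_eqF.
Qed.

End sequence_norms.

(** * Integrals and L^p norms of functions that need not be measurable *)

Section measure_lemmas.
Context {R : realType} {d} {T : measurableType d} (mu : {measure set T -> \bar R}).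

(** The integral of a non-negative function is a supremum over the simple
    functions below it, hence monotone without measurability; this spares the
    measurability of norms of vector-valued functions. *)
Lemma le_integral_nonmeasurable (f g : T -> \bar R) :
  (forall x, 0 <= f x)%E -> (forall x, f x <= g x)%E ->
  (\int[mu]_x f x <= \int[mu]_x g x)%E.
Proof.
move=> f0 fg; rewrite !ge0_integralTE//; last by move=> x; exact: le_trans (fg x).
by apply: ereal_sup_le => _ [h hf <-]; exists h => // x; exact: le_trans (fg x).
Qed.

Lemma integral_ae0 (f : T -> \bar R) : (forall x, 0 <= f x)%E ->
  {ae mu, forall x, f x = 0%E} -> (\int[mu]_x f x = 0)%E.
Proof.
move=> f0 [A [mA A0 Af]]; apply/eqP; rewrite eq_le integral_ge0// andbT.
rewrite -(@null_set_integral _ _ _ mu A (cst +oo%E) mA _ A0)//.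
rewrite [leRHS]integral_mkcond; apply: le_integral_nonmeasurable => // x.
rewrite patchE; case: ifPn => [_|/negP xA]; first exact: leey.
have [->//|fx] := eqVneq (f x) 0%E.
by exfalso; apply: xA; rewrite inE; apply: Af => /= h; rewrite h eqxx in fx.
Qed.

Lemma integral_indic_cst (c : R) (D : set T) : measurable D -> 0 <= c ->
  (\int[mu]_x (c * \1_D x)%:E = c%:E * mu D)%E.
Proof.
move=> mD c0; under eq_integral do rewrite EFinM.
rewrite ge0_integralZl//; first by rewrite integral_indic// setIT.
by apply/measurable_EFinP; exact: measurable_indic.
Qed.

Lemma Lnorm_le_on (p c : R) (D : set T) (f : T -> \bar R) :
  0 < p -> 0 <= c -> measurable D -> (forall x, D x -> `|f x| <= c%:E)%E ->
  (forall x, ~ D x -> f x = 0%E) ->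
  ('N[mu]_(p%:E)[f] <= c%:E * mu D `^ p^-1)%E.
Proof.
move=> p0 c0 mD fD f0; rewrite unlock.
have -> : (c%:E * mu D `^ p^-1 = ((c `^ p)%:E * mu D) `^ p^-1)%E.
  rewrite poweRM ?lee_fin ?powR_ge0// poweR_EFin -powRrM mulfV ?gt_eqF//.
  by rewrite powRr1.
apply: gt0_ler_poweR; rewrite ?invr_ge0 ?(ltW p0)//.
- by rewrite in_itv/= leey andbT integral_ge0// => x _; exact: poweR_ge0.
- by rewrite in_itv/= leey andbT mule_ge0 ?lee_fin ?powR_ge0.
rewrite -integral_indic_cst ?powR_ge0//; apply: le_integral_nonmeasurable => x.
  exact: poweR_ge0.
rewrite indicE; case: (boolP (x \in D)) => [/set_mem|/negP] Dx.
  rewrite mulr1 -poweR_EFin; apply: gt0_ler_poweR; rewrite ?(ltW p0)//.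
  - by rewrite in_itv/= leey andbT.
  - by rewrite in_itv/= leey andbT lee_fin.
  - exact: fD.
by rewrite mulr0 f0 ?abse0 ?poweR0r ?gt_eqF// => Dx'; apply: Dx; rewrite inE.
Qed.

Lemma Lnorm_ge_on (p c : R) (D : set T) (f : T -> \bar R) :
  0 < p -> 0 <= c -> measurable D -> (forall x, D x -> c%:E <= `|f x|)%E ->
  (c%:E * mu D `^ p^-1 <= 'N[mu]_(p%:E)[f])%E.
Proof.
move=> p0 c0 mD fD; rewrite unlock.
have -> : (c%:E * mu D `^ p^-1 = ((c `^ p)%:E * mu D) `^ p^-1)%E.
  rewrite poweRM ?lee_fin ?powR_ge0// poweR_EFin -powRrM mulfV ?gt_eqF//.
  by rewrite powRr1.
apply: gt0_ler_poweR; rewrite ?invr_ge0 ?(ltW p0)//.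
- by rewrite in_itv/= leey andbT mule_ge0 ?lee_fin ?powR_ge0.
- by rewrite in_itv/= leey andbT integral_ge0// => x _; exact: poweR_ge0.
rewrite -integral_indic_cst ?powR_ge0//; apply: le_integral_nonmeasurable => x.
  by rewrite lee_fin mulr_ge0 ?powR_ge0.
rewrite indicE; case: (boolP (x \in D)) => [/set_mem Dx|_].
  rewrite mulr1 -poweR_EFin; apply: gt0_ler_poweR; rewrite ?(ltW p0)//.
  - by rewrite in_itv/= leey andbT lee_fin.
  - by rewrite in_itv/= leey andbT.
  - exact: fD.
by rewrite mulr0 poweR_ge0.
Qed.

End measure_lemmas.

(** * Measurable functions with finitely many values *)

Section finitely_valued.
Context {d} {T : measurableType d}.

Definition finitely_valued {A : Type} (f : T -> A) : Prop :=
  finite_set (range f) /\ forall a, measurable (f @^-1` [set a]).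

Lemma finitely_valued_comp2 {A B C : Type} (op : A -> B -> C) f g :
  finitely_valued f -> finitely_valued g ->
  finitely_valued (fun t => op (f t) (g t)).
Proof.
move=> [ff mf] [fg mg]; split.
  apply: sub_finite_set (finite_image2 op ff fg).
  by move=> _ [t _ <-]; exists (f t); [exists t|exists (g t); [exists t|]].
move=> c.
have -> : (fun t => op (f t) (g t)) @^-1` [set c] =
  \bigcup_(z in (range f `*` range g) `&` [set z | op z.1 z.2 = c])
    (f @^-1` [set z.1] `&` g @^-1` [set z.2]).
  apply/seteqP; split => [t /= <-|t [[a b] [_ /= <-]] [/= -> ->]//].
  by exists (f t, g t) => //; split => //; split; exists t.
apply: fin_bigcup_measurable => [|z _]; last exact: measurableI.
by apply: finite_setIl; exact: finite_setX.
Qed.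

Lemma finitely_valued_cst {A : Type} (a : A) : finitely_valued (fun _ : T => a).
Proof.
split=> [|b].
  by apply: sub_finite_set (finite_set1 a) => _ [_ _ <-].
by rewrite preimage_cst; case: ifP => _; [exact: measurableT|exact: measurable0].
Qed.

Lemma finitely_valued_comp {A B : Type} (g : A -> B) f :
  finitely_valued f -> finitely_valued (fun t => g (f t)).
Proof.
move=> ff.
exact: (@finitely_valued_comp2 _ _ _ (fun a _ => g a) _ _ ff (finitely_valued_cst tt)).
Qed.

Lemma finitely_valued_sum {R : realType} {V : lmodType R} {I : Type} (r : seq I)
    (F : I -> T -> V) :
  (forall i, finitely_valued (F i)) ->
  finitely_valued (fun t => \sum_(i <- r) F i t).
Proof.
move=> FF; elim: r => [|i r IH].
  under eq_fun do rewrite big_nil; exact: finitely_valued_cst.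
under eq_fun do rewrite big_cons.
exact: (finitely_valued_comp2 (fun u v => u + v)).
Qed.

Lemma finitely_valued_indic {R : realType} (A : set T) :
  measurable A -> finitely_valued (\1_A : T -> R).
Proof.
move=> mA; rewrite /indic; apply: (finitely_valued_comp (fun b : bool => b%:R)).
split=> [|b]; first exact: finite_finset.
have -> : (fun t => t \in A) @^-1` [set b] = if b then A else ~` A.
  apply/seteqP; split => t /=; case: b => /=.
  - by move/set_mem.
  - by move=> tA At; rewrite mem_set in tA.
  - by move=> At; rewrite mem_set.
  - by move=> At; apply/negbTE/negP => /set_mem.
by case: b => //; exact: measurableC.
Qed.

Lemma finitely_valued_sfun {R : realType} (f : {sfun T >-> R}) : finitely_valued f.
Proof. by split => // a; rewrite -[X in measurable X]setTI; exact: measurable_funP. Qed.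

End finitely_valued.

(** * Functions with values in a single column *)

Section columns.
Context {R : realType}.

Definition column (n j : nat) (a : nat -> R) : seq2 R :=
  fun i' j' => if (i' < n)%N && (j' == j) then a i' else 0.

Lemma column_sum n j a :
  column n j a = \sum_(i < n) a i *: column i.+1 j (fun k => (k == i)%:R).
Proof.
apply/funext => i'; apply/funext => j'.
rewrite (_ : (\sum_(i < n) _) i' j' =
   \sum_(i < n) a i * column i.+1 j (fun k => (k == i)%:R) i' j'); last first.
  elim/big_rec2: _ => // i y1 y2 _ <-//.
rewrite /column; have [i'n|ni'] := ltnP i' n; last first.
  rewrite big1//= => i _; rewrite ltnNge (leq_trans (ltn_ord i) ni')//=.
  by rewrite mulr0.
rewrite (bigD1 (Ordinal i'n))//= ltnSn eqxx/=.
rewrite big1 ?addr0 => [|i ii'].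
  by case: ifP; rewrite ?mulr1 ?mulr0.
case: ifP; rewrite ?mulr0// => _.
by rewrite (_ : i' == i = false) ?mulr0//; apply/negbTE; rewrite eq_sym.
Qed.

Lemma columnB n j a b : column n j a - column n j b = column n j (fun i => a i - b i).
Proof.
apply/funext => i'; apply/funext => j'.
rewrite (_ : (_ - _) i' j' = column n j a i' j' - column n j b i' j')//.
by rewrite /column; case: ifP => // _; rewrite subr0.
Qed.

Lemma lplq_norm_column_le (p q : R) n j a : 1 <= p -> 1 <= q ->
  (lplq_norm p q (column n j a) <= (\sum_(i < n) `|a i|)%:E)%E.
Proof.
move=> p1 q1; apply: (le_trans (@lplq_norm_le_sum _ _ _ n j.+1 _ p1 q1 _)).
  move=> i' j'; rewrite /column; case: (ltnP i' n) => //= _.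
  by case: eqP => // ->; rewrite ltnSn.
rewrite lee_fin; apply: ler_sum => i _.
rewrite big_ord_recr/= big1 ?add0r /column ?ltn_ord ?eqxx// => j' _.
by rewrite ltn_eqF ?normr0// ltn_ord.
Qed.

(** Each entry is at most [(sum_i a_i ^ p) ^ (1 / p)]. *)
Lemma powR_sum_le_sum_powR n (a : 'I_n -> R) (p : R) :
  0 < p -> (forall i, 0 <= a i) ->
  (\sum_(i < n) a i) `^ p <= n%:R `^ p * \sum_(i < n) a i `^ p.
Proof.
move=> p0 a0; set S := \sum_(i < n) a i `^ p.
have S0 : 0 <= S by apply: sumr_ge0 => i _; exact: powR_ge0.
have -> : S = (S `^ p^-1) `^ p by rewrite -powRrM mulVf ?gt_eqF// powRr1.
rewrite -powRM ?powR_ge0//; apply: ge0_ler_powR; rewrite ?nnegrE ?(ltW p0)//.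
- exact: sumr_ge0.
- by rewrite mulr_ge0 ?powR_ge0.
have -> : n%:R * S `^ p^-1 = \sum_(i < n) S `^ p^-1.
  by rewrite sumr_const card_ord mulr_natl.
apply: ler_sum => i _.
have -> : a i = (a i `^ p) `^ p^-1 by rewrite -powRrM mulfV ?gt_eqF// powRr1.
apply: ge0_ler_powR; rewrite ?nnegrE ?invr_ge0 ?(ltW p0) ?powR_ge0//.
by rewrite /S (bigD1 i)//= lerDl sumr_ge0// => ? _; exact: powR_ge0.
Qed.

Lemma cvg_sum0 n (a : nat -> nat -> R) :
  (forall i, (i < n)%N -> a i m @[m --> \oo] --> 0) ->
  \sum_(i < n) a i m @[m --> \oo] --> 0.
Proof.
elim: n => [_|n IH a0].
  by under eq_fun do rewrite big_ord0; exact: cvg_cst.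
under eq_fun do rewrite big_ord_recr/=.
have /IH sum0 : forall i, (i < n)%N -> a i m @[m --> \oo] --> 0.
  by move=> i ni; apply: a0; rewrite ltnS ltnW.
have := cvgD sum0 (a0 n (ltnSn n)); rewrite addr0; exact.
Qed.

Context {d} {T : measurableType d} (mu : {measure set T -> \bar R}).

Lemma finitely_valued_column n j (f : nat -> T -> R) :
  (forall i, finitely_valued (f i)) ->
  finitely_valued (fun t => column n j (f^~ t)).
Proof.
move=> ff; under eq_fun do rewrite column_sum.
apply: finitely_valued_sum => i.
exact: (finitely_valued_comp (fun b : R => b *: _)).
Qed.

(** Approximating each of the finitely many coordinates by real simple
    functions suffices, as [lplq_norm_column_le] bounds the norm of the error. *)
Lemma strongly_measurable_column (p q : R) n j (f : nat -> T -> R) :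
  1 <= p -> 1 <= q -> (forall i, measurable_fun setT (f i)) ->
  strongly_measurable (lplq_norm p q) mu (fun t => column n j (f^~ t)).
Proof.
move=> p1 q1 mf.
have /choice[g gf] i : exists g : nat -> {sfun T >-> R},
    forall t, EFin \o g ^~ t @ \oo --> (f i t)%:E.
  have [|g gP] := @approximation_sfun _ T R (EFin \o f i) setT measurableT.
    exact: measurableT_comp.
  by exists g => t; exact: gP.
exists (fun m t => column n j (fun i => g i m t)); split.
  move=> m; have [ff mfv] := @finitely_valued_column n j (fun i => g i m)
    (fun i => finitely_valued_sfun _).
  split => // t; apply: le_lt_trans (lplq_norm_column_le _ _ _ p1 q1) _.
  exact: ltry.
apply/nearW => t.
apply: (@squeeze_cvge _ _ _ _ (fun=> 0%E) _
  (fun m => (\sum_(i < n) `|g i m t - f i t|)%:E)).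
- apply/nearW => m; rewrite lplq_norm_ge0/= columnB.
  exact: lplq_norm_column_le.
- exact: cvg_cst.
apply: cvg_EFin; first exact/nearW.
apply: (@cvg_sum0 n (fun i m => `|g i m t - f i t|)) => i _.
rewrite -(normr0 R) -(subrr (f i t)).
apply: cvg_norm; apply: cvgB; last exact: cvg_cst.
by have /fine_cvgP[_] := gf i t.
Qed.

Lemma Lp_space_column (r p q : R) n j (f : nat -> T -> R) :
  0 < r -> 1 <= p -> 1 <= q -> (forall i, measurable_fun setT (f i)) ->
  (forall i, (i < n)%N -> \int[mu]_t (`|f i t| `^ r)%:E < +oo)%E ->
  Lp_space (lplq_norm p q) mu r (fun t => column n j (f^~ t)).
Proof.
move=> r0 p1 q1 mf If; split; first exact: strongly_measurable_column.
rewrite /Lp_norm unlock; apply: poweR_lty.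
pose h t := (n%:R `^ r * \sum_(i < n) `|f i t| `^ r)%:E.
apply: (@le_lt_trans _ _ (\int[mu]_t h t)%E).
  apply: le_integral_nonmeasurable => t; first exact: poweR_ge0.
  apply: (@le_trans _ _ ((\sum_(i < n) `|f i t|) `^ r)%:E); last first.
    by rewrite lee_fin powR_sum_le_sum_powR.
  rewrite -poweR_EFin gee0_abs ?lplq_norm_ge0//.
  apply: gt0_ler_poweR; rewrite ?(ltW r0)//.
  - by rewrite in_itv/= leey andbT lplq_norm_ge0.
  - by rewrite in_itv/= leey andbT lee_fin sumr_ge0.
  - exact: lplq_norm_column_le.
have mfr i : measurable_fun setT (fun t => (`|f i t| `^ r)%:E).
  apply/measurable_EFinP.
  by apply: (measurableT_comp (measurable_powR _)); exact: measurableT_comp.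
rewrite /h; under eq_integral do rewrite EFinM -sumEFin.
rewrite ge0_integralZl//; last 2 first.
- exact: emeasurable_sum.
- by move=> t _; apply: sume_ge0 => i _; rewrite lee_fin powR_ge0.
rewrite ge0_integral_sum//.
apply: lte_mul_pinfty => //.
apply: lte_sum_pinfty => i _; exact: If.
Qed.

End columns.

(** * Counting cells by dyadic distance *)

Section dyadic_cells.
Context {R : realType}.

Definition cell (i : nat) : set R := `]i%:R, i.+1%:R]%classic.

Lemma mem_cell i t : (t \in cell i) = (i%:R < t <= i.+1%:R).
Proof. by apply/idP/idP; rewrite inE /cell /= in_itv. Qed.

Lemma measurable_cell i : measurable (cell i).
Proof. exact: measurable_itv. Qed.

Lemma exists_cell (n : nat) (t : R) : 0 < t -> t <= n%:R ->
  exists2 i0, (i0 < n)%N & forall i, (t \in cell i) = (i == i0).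
Proof.
move=> t0 tn.
have tn' : exists k, t <= k%:R by exists n.
have := ex_minnP tn' => -[[|k] tk kmin]; first by move: tk; rewrite leNgt t0.
have kt : k%:R < t.
  by rewrite ltNge; apply/negP => /kmin; rewrite ltnn.
exists k; first exact: (kmin n).
move=> i; rewrite mem_cell; apply/andP/eqP => [[it ti]|->//].
apply/eqP; rewrite eqn_leq; apply/andP; split; rewrite -ltnS -(ltr_nat R).
  exact: lt_le_trans it tk.
exact: lt_le_trans kt ti.
Qed.

(** At time [t] the row [i] is evaluated at the scale [j]: its cell has passed, and
    it still lies in the window of length [2 ^ (j + 1)]. *)
Definition dyadic (t : R) (i j : nat) : bool := 2 ^+ j < t - i%:R <= 2 ^+ j.+1.

Lemma dyadic_inj t i j j' : dyadic t i j -> dyadic t i j' -> j = j'.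
Proof.
move=> /andP[h1 h2] /andP[h3 h4]; have E a b : (a < b)%N = ((2 : R) ^+ a < 2 ^+ b) by rewrite ltr_eXn2l// ltr1n.
apply/eqP; rewrite eqn_leq; apply/andP; split; rewrite -ltnS E.
  exact: lt_le_trans h1 h4.
exact: lt_le_trans h3 h2.
Qed.

Lemma ler_sum_subrange (F : nat -> R) lo hi n : (forall i, 0 <= F i) ->
  (lo <= hi)%N -> (hi <= n)%N ->
  \sum_(lo <= i < hi) F i <= \sum_(i < n) F i.
Proof.
move=> F0 lh hn; rewrite -(big_mkord xpredT F).
rewrite (@big_cat_nat _ _ _ hi 0 n)//= (@big_cat_nat _ _ _ lo 0 hi)//=.
rewrite -addrA addrCA lerDl addr_ge0// sumr_ge0//.
Qed.

(** With [K < t <= K + 1] the cells in question are those with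
    [K + 1 - 2 ^ (j + 1) <= i < K + 1 - 2 ^ j]; their indices are natural numbers
    below [2 ^ (J + 1)], because [2 ^ J <= K < 2 ^ (J + 1)]. *)
Lemma count_dyadic (J j : nat) (t : R) : (j < J)%N ->
  (2 ^ J)%:R < t -> t <= (2 * 2 ^ J)%:R ->
  2 ^+ j <= \sum_(i < 2 * 2 ^ J) (dyadic t i j)%:R :> R.
Proof.
move=> jJ Mt tM.
have t0 : 0 < t by rewrite (le_lt_trans _ Mt).
have [K KM /(_ K)] := exists_cell t0 tM; rewrite eqxx mem_cell => /andP[Kt tK].
have MK : (2 ^ J <= K)%N by rewrite -ltnS -(ltr_nat R) (lt_le_trans Mt).
have bM : (2 ^ j.+1 <= 2 ^ J)%N by rewrite leq_exp2l.
have bK : (2 ^ j.+1 <= K.+1)%N by rewrite (leq_trans bM)// (leq_trans MK).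
have ab : (2 ^ j <= 2 ^ j.+1)%N by rewrite leq_exp2l.
apply: le_trans (@ler_sum_subrange (fun i => (dyadic t i j)%:R)
  (K.+1 - 2 ^ j.+1) (K.+1 - 2 ^ j) _ _ _ _) => //; last 2 first.
- exact: leq_sub2l.
- by rewrite (leq_trans (leq_subr _ _)).
rewrite big_nat (eq_bigr (fun=> 1)) => [|i /andP[bi ia]]; last first.
  rewrite /dyadic -!natrX (_ : _ && _ = true)//; apply/andP; split.
    rewrite ltrBrDr -natrD; apply: le_lt_trans Kt; rewrite ler_nat.
    by rewrite -ltnS -ltn_subRL.
  rewrite lerBlDr -natrD; apply: le_trans tK _; rewrite ler_nat.
  by rewrite -leq_subLR.
rewrite -big_nat sumr_const_nat -natrX ler_nat.
by move: bK; rewrite expnS; lia.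
Qed.

Lemma sum_dyadic_ge (J : nat) (t : R) :
  (2 ^ J)%:R < t -> t <= (2 * 2 ^ J)%:R ->
  J%:R / 4 <= \sum_(i < 2 * 2 ^ J) \sum_(j < J)
    (dyadic t i j)%:R * (2 ^+ j.+2)^-1 :> R.
Proof.
move=> Mt tM; rewrite exchange_big/=.
have -> : J%:R / 4 = \sum_(j < J) 4^-1 :> R.
  by rewrite sumr_const card_ord mulr_natl.
apply: ler_sum => j _; rewrite -mulr_suml.
apply: le_trans (ler_wpM2r _ (count_dyadic (ltn_ord j) Mt tM)).
  by rewrite !exprS mulrA invfM mulrCA mulfV ?mulr1 ?expf_neq0// -natrM.
by rewrite invr_ge0 exprn_ge0.
Qed.

(** At any time at most one cell is active. *)
Lemma lplq_norm_cell (p q : R) n m (y : seq2 R) (t : R) : 0 < p -> 0 < q ->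
  (forall i j, `|y i j| = ((i < n) && (j < m))%N%:R * \1_(cell i) t) ->
  lplq_norm p q y = if 0 < t <= n%:R then (m%:R `^ q^-1)%:E else 0%E.
Proof.
move=> p0 q0 yE; case: ifP => [/andP[t0 tn]|tn].
  have [i0 i0n i0P] := exists_cell t0 tn.
  apply: (@lplq_norm_signs _ p q i0) => // i j.
  rewrite yE indicE i0P; case: eqP => [->|_]; last by rewrite mulr0.
  by rewrite i0n mulr1.
rewrite (_ : y = 0) ?lplq_norm0//; apply/funext => i; apply/funext => j.
apply/eqP; rewrite -normr_eq0 yE indicE mem_cell.
case: (ltnP i n) => [ni|]; last by rewrite mul0r.
case: (boolP (_ < t <= _)) => [/andP[it ti]|_]; last by rewrite mulr0.
move: tn; rewrite (le_lt_trans _ it)//= (le_trans ti)// ler_nat//.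
Qed.

Lemma sum_seq2E {T I : Type} (r : seq I) (F : I -> T -> seq2 R) t i j :
  (\sum_(k <- r) F k) t i j = \sum_(k <- r) F k t i j.
Proof. by elim/big_rec2: _ => // k y1 y2 _ <-. Qed.

End dyadic_cells.

(** * Box kernels *)

Section kernels.
Context {R : realType}.
Local Notation leb := (@lebesgue_measure R).

(** The factor 2 makes [box_kernel d] half of an average over the past [d]
    units of time, hence bounded by the average over the ball of radius [d]. *)
Definition box_kernel (d t : R) : R := (2 * d)^-1 * \1_(`[0, d[) t.

Lemma box_kernel_ge0 (d t : R) : 0 < d -> 0 <= box_kernel d t.
Proof. by move=> d0; rewrite mulr_ge0// invr_ge0 mulr_ge0// ltW. Qed.

Lemma measurable_box_kernel (d : R) : measurable_fun setT (box_kernel d).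
Proof. by apply: measurable_funM => //; exact: measurable_indic. Qed.

Lemma Ktilde_box_kernel (d : R) : 0 < d -> Ktilde (box_kernel d).
Proof.
move=> d0; have c0 : 0 <= (2 * d)^-1 by rewrite invr_ge0 mulr_ge0// ltW.
split.
  apply/integrableP; split.
    by apply/measurable_EFinP; exact: measurable_box_kernel.
  under eq_integral do rewrite /= ger0_norm ?box_kernel_ge0//.
  rewrite integral_indic_cst//= lebesgue_measure_itv/= lte_fin d0.
  by rewrite -EFinD -EFinM ltry.
move=> f; apply/nearW => xi.
have mf : measurable_fun [set: measurableTypeR R] f by exact: measurable_funP.
have mk : measurable_fun [set: measurableTypeR R] (fun eta : R => box_kernel d (xi - eta)).
  apply: measurableT_comp; first exact: measurable_box_kernel.
  exact: measurable_funB.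
have mB : measurable (ball xi d) by exact: measurable_ball.
apply: (@le_trans _ _ (iavg f (ball xi d))); last first.
  apply: ereal_sup_ubound; exists d => //=.
  by rewrite in_itv/= andbT.
apply: (@le_trans _ _
    (\int[leb]_eta `|(box_kernel d (xi - eta) * f eta)%:E|)%E).
  apply: (@le_trans _ _ `|\int[leb]_eta (box_kernel d (xi - eta) * f eta)%:E|%E).
    rewrite /convolution /Rintegral.
    by case: (\int[_]_eta _)%E => [r| |]//=; rewrite ?normr0 ?leey.
  by apply: le_abse_integral => //; apply/measurable_EFinP; exact: measurable_funM.
rewrite /iavg lebesgue_measure_ball ?(ltW d0)//.
rewrite inver mulrn_eq0/= gt_eqF// -ge0_integralZl//; last 2 first.
- by apply: measurable_funTS; apply/measurable_EFinP; exact: measurableT_comp.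
- by rewrite lee_fin invr_ge0 mulrn_wge0// ltW.
rewrite [leRHS]integral_mkcond.
apply: le_integral_nonmeasurable => eta; first by rewrite lee_fin.
rewrite normrM ger0_norm ?box_kernel_ge0// /box_kernel indicE patchE.
case: (boolP (xi - eta \in _)) => [|_]; last first.
  rewrite mulr0 mul0r; case: ifP => // _.
  by rewrite mule_ge0// lee_fin invr_ge0 mulrn_wge0// ltW.
rewrite inE/= in_itv/= => /andP[h1 h2]; rewrite mulr1 mem_set.
  by rewrite -EFinM mulr_natl.
by rewrite /ball/= ger0_norm.
Qed.

Lemma Ktilde_plus_box_kernel (d : R) : 0 < d -> Ktilde_plus (box_kernel d).
Proof.
move=> d0; split; last exact: Ktilde_box_kernel.
move=> t t0; rewrite /box_kernel indicE memNset ?mulr0//=.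
by rewrite in_itv/= leNgt t0.
Qed.

(** The whole cell lies in the window of the kernel. *)
Lemma Tconv_box_kernel_cell (d t : R) (x : R -> seq2 R) i j :
  (forall s, x s i j = \1_(cell i) s) -> i.+1%:R <= t -> t - i%:R <= d ->
  Tconv (box_kernel d) x t i j = (2 * d)^-1.
Proof.
move=> xE it td; rewrite /Tconv /Rintegral.
transitivity (fine (\int[leb]_(s in `[0%R, t]) ((2 * d)^-1 * \1_(cell i) s)%:E)%E).
  congr fine; apply: eq_integral => s; rewrite inE/= in_itv/= => /andP[s0 st].
  rewrite xE /box_kernel -mulrA; congr (_ * _)%:E; rewrite !indicE mem_cell.
  case: (boolP (_ < s <= _)) => [/andP[lis uis]|_]; last by rewrite mulr0.
  rewrite mem_set ?mulr1//= in_itv/= subr_ge0 st/=.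
  by move: lis td; lra.
under eq_integral do rewrite EFinM.
rewrite ge0_integralZl//; last 2 first.
- by apply: measurable_funTS; apply/measurable_EFinP; apply: measurable_indic; exact: measurable_cell.
- by rewrite lee_fin invr_ge0 mulr_ge0// (le_trans _ td)// subr_ge0 (le_trans _ it)// ler_nat.
rewrite integral_indic//; last exact: measurable_cell.
rewrite setIidl; last first.
  move=> s /=; rewrite /cell /= !in_itv/= => /andP[lis uis].
  by rewrite (le_trans _ (ltW lis))//= (le_trans uis it).
rewrite /= /cell lebesgue_measure_itv/= lte_fin ltr_nat ltnSn -EFinD.
by rewrite -natrB// subSnn mule1.
Qed.

End kernels.

(** * Failure of l^1-boundedness *)

Section failure_of_ell1_boundedness.
Context {R : realType}.

Lemma leb_plus_itvoc (a b : R) : 0 <= a -> a <= b ->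
  (leb_plus `]a, b]%classic = (b - a)%:E)%E.
Proof.
move=> a0 ab; rewrite /leb_plus /leb_on /= /mrestr setIidl; last first.
  move=> s /=; rewrite !in_itv/= => /andP[lis _].
  by rewrite (le_trans a0 (ltW lis)).
rewrite lebesgue_measure_itv/= lte_fin; case: ltP => // ba.
by rewrite (le_anti (_ : a <= b <= a)) ?ab// subrr.
Qed.

Lemma sum_column_in n J (a : 'I_J -> nat -> R) i (j : 'I_J) :
  \sum_(k < J) column n k (a k) i j = if (i < n)%N then a j i else 0.
Proof.
rewrite (bigD1 j)//= /column eqxx andbT big1 ?addr0// => k kj.
by rewrite (_ : (val j == k) = false) ?andbF//; apply/negbTE; rewrite eq_sym.
Qed.

Lemma sum_column_out n J (a : 'I_J -> nat -> R) i j : (J <= j)%N ->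
  \sum_(k < J) column n k (a k) i j = 0.
Proof.
move=> Jj; rewrite big1// => k _.
by rewrite /column (gtn_eqF (leq_trans (ltn_ord k) Jj)) andbF.
Qed.

Lemma norm_column n j (a : nat -> R) i' j' :
  `|column n j a i' j'| = column n j (fun i => `|a i|) i' j'.
Proof. by rewrite /column; case: ifP; rewrite ?normr0. Qed.

Lemma Lp_space_cell_column (p q r : R) n j : 0 < r -> 1 <= p -> 1 <= q ->
  Lp_space (lplq_norm p q) (@leb_plus R) r
    (fun t => column n j (fun i => \1_(cell i) t)).
Proof.
move=> r0 p1 q1; apply: Lp_space_column => // [i|i _].
  by apply: measurable_indic; exact: measurable_cell.
rewrite (eq_integral (fun t : measurableTypeR R => (1 * \1_(cell i) t)%:E)); last first.
  move=> t _; congr (_%:E); rewrite indicE.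
  by case: (_ \in _); rewrite ?normr1 ?normr0 ?powR1 ?powR0 ?gt_eqF ?mulr0 ?mulr1.
rewrite integral_indic_cst//; last exact: measurable_cell.
by rewrite leb_plus_itvoc ?ler_nat// -EFinM ltry.
Qed.

Lemma not_ell1_bounded_Ktilde (p : R) : 1 < p ->
  ~ ell1_bounded (Lp_space (lplq_norm 1 2) (@leb_plus R) p)
      (Lp_norm (lplq_norm 1 2) (@leb_plus R) p) abs_fun
      [set T | exists2 k, Ktilde_plus k & T = Tconv k].
Proof.
move=> p1 [C C0 bdd]; have p0 : 0 < p by rewrite (lt_trans _ p1).
(* The factor 8 makes up for the 4 in the lower bound and for
   [2 ^ (1 / p) <= 2], where 2 is the ratio of the measures of [D0] and [D]. *)
have [J CJ] : exists J : nat, (8 * C) ^+ 2 < J%:R.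
  by exists (Num.truncn ((8 * C) ^+ 2)).+1; exact: truncnS_gt.
set M := (2 ^ J)%N.
pose d (j : nat) : R := 2 ^+ j.+1.
have d0 j : 0 < d j by rewrite exprn_gt0.
pose x (j : 'I_J) (t : R) := column (2 * M) j (fun i => \1_(cell i) t : R).
have le12 : 1 <= 2 :> R by rewrite ler1n.
have xT j : (exists2 k, Ktilde_plus k & Tconv (box_kernel (d j)) = Tconv k).
  by exists (box_kernel (d j)) => //; exact: Ktilde_plus_box_kernel.
have := bdd J (fun j => Tconv (box_kernel (d j))) x xT
  (fun j => Lp_space_cell_column _ _ p0 (lexx 1) le12).
apply/negP; rewrite -ltNge.
pose D : set R := `]M%:R, (2 * M)%:R]%classic.
pose D0 : set R := `]0, (2 * M)%:R]%classic.
have M0 : 0 < M%:R :> R by rewrite ltr0n expn_gt0.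
have mD : leb_plus D = M%:R%:E.
  by rewrite leb_plus_itvoc ?ler_nat ?leq_pmull// -natrB ?leq_pmull// mul2n -addnn addnK.
have mD0 : leb_plus D0 = (2 * M)%:R%:E.
  by rewrite leb_plus_itvoc// subr0.
have upper : (Lp_norm (lplq_norm 1 2) (@leb_plus R) p (\sum_(i < J) abs_fun (x i))%R
    <= (J%:R `^ 2^-1)%:E * leb_plus D0 `^ p^-1)%E.
  have E t : lplq_norm 1 2 ((\sum_(i < J) abs_fun (x i)) t) =
      if 0 < t <= (2 * M)%:R then (J%:R `^ 2^-1)%:E else 0%E.
    apply: lplq_norm_cell => // i j; rewrite sum_seq2E.
    under eq_bigr do rewrite /abs_fun norm_column.
    have [jJ|Jj] := ltnP j J; last by rewrite sum_column_out// normr0 andbF mul0r.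
    rewrite (sum_column_in _ _ _ (Ordinal jJ)) andbT.
    by case: ifP; rewrite ?normr0 ?mul0r// normr_id mul1r ger0_norm.
  apply: Lnorm_le_on => //=; first exact: measurable_itv.
    by move=> t; rewrite /D0/= in_itv/= E => ->; rewrite /= ger0_norm ?powR_ge0.
  by move=> t; rewrite /D0/= in_itv/= E; case: ifP.
have lower : ((J%:R / 4)%:E * leb_plus D `^ p^-1 <=
    Lp_norm (lplq_norm 1 2) (@leb_plus R) p
     (\sum_(i < J) abs_fun (Tconv (box_kernel (d i)) (x i)))%R)%E.
  apply: Lnorm_ge_on => //; first exact: measurable_itv.
  move=> t; rewrite /D/= in_itv/= => /andP[Mt tM].
  rewrite gee0_abs ?lplq_norm_ge0//=.
  set y := (\sum_(i < J) _) t.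
  have yE i j : y i j = \sum_(k < J) `|Tconv (box_kernel (d k)) (x k) t i j|.
    by rewrite /y sum_seq2E.
  have Tconv0 k i j : (forall s, x k s i j = 0) -> Tconv (box_kernel (d k)) (x k) t i j = 0.
    move=> x0; rewrite /Tconv /Rintegral.
    by under eq_integral do rewrite x0 mulr0; rewrite integral0.
  rewrite -[leRHS]poweRe1 ?lplq_norm_ge0//.
  apply: le_trans (@lplq_norm_ge_selection _ 1 2 (2 * M) J y (dyadic t) _ _ _ _) => //.
  - rewrite lee_fin; apply: le_trans (sum_dyadic_ge Mt tM) _.
    apply: ler_sum => i _; apply: ler_sum => j _.
    case: (boolP (dyadic t i j)) => [/andP[h1 h2]|_]; last by rewrite !mul0r.
    rewrite !mul1r powRr1// yE ger0_norm ?sumr_ge0// (bigD1 j)//=.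
    rewrite (@Tconv_box_kernel_cell _ _ _ _ i j); first last.
    + exact: h2.
    + rewrite -natr1; have := exprn_ege1 j le12; lra.
    + by move=> s; rewrite /x /column ltn_ord eqxx.
    rewrite ger0_norm; last by rewrite invr_ge0 mulr_ge0// ltW.
    by rewrite /d -exprS lerDl sumr_ge0.
  - move=> i j ij; rewrite yE big1// => k _; apply/normr0P/eqP/Tconv0 => s.
    rewrite /x /column; case: (ltnP i (2 * M)) ij => //= _.
    by rewrite -leqNgt => Jj; rewrite (gtn_eqF (leq_trans (ltn_ord k) Jj)).
  - by move=> i j j'; exact: dyadic_inj.
apply: lt_le_trans lower; apply: le_lt_trans (lee_pmul _ _ (lexx C%:E) upper) _ => //.
  exact: Lnorm_ge0.
rewrite mD mD0 !poweR_EFin -!EFinM lte_fin natrM powRM ?ler0n//.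
set a := M%:R `^ p^-1; have a0 : 0 < a by exact: powR_gt0.
rewrite !mulrA ltr_pM2r//.
have h2 : 2 `^ p^-1 <= 2 :> R.
  rewrite -[leRHS]powRr1//; apply: ler_powR; first exact: le12.
  by rewrite invf_le1// ltW.
have J0 : 0 < J%:R :> R by rewrite (le_lt_trans _ CJ)// sqr_ge0.
set b := J%:R `^ 2^-1; have b0 : 0 < b by exact: powR_gt0.
have bb : b * b = J%:R by rewrite -expr2 /b powR12_sqrt ?sqr_sqrtr// ltW.
have Cb : 8 * C < b.
  rewrite -(ltr_pXn2r (_ : 0 < 2)%N) ?nnegrE ?mulr_ge0 ?(ltW b0)//.
  by rewrite expr2 [ltRHS]expr2 bb -expr2.
apply: (@le_lt_trans _ _ (C * b * 2)).
  by apply: ler_wpM2l => //; rewrite mulr_ge0// ltW.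
rewrite -bb; nra.
Qed.

End failure_of_ell1_boundedness.

(** * Moments of centred Gaussian variables *)

Section gaussian_moments.
Context {R : realType}.
Local Notation leb := (@lebesgue_measure R).

(** The density is the Radon-Nikodym derivative almost everywhere. *)
Lemma integral_normal_prob (m s : R) (f : R -> \bar R) :
  measurable_fun setT f -> (forall x, 0 <= f x)%E ->
  (\int[normal_prob m s]_x f x = \int[leb]_x (f x * (normal_pdf m s x)%:E))%E.
Proof.
move=> mf f0; have dom := normal_prob_dominates m s.
rewrite -(Radon_Nikodym_SigmaFinite.change_of_variables dom f0)//.
have mpdf : measurable_fun setT (fun x => (normal_pdf m s x)%:E).
  by apply/measurable_EFinP; exact: measurable_normal_pdf.
have iRN := Radon_Nikodym_SigmaFinite.f_integrable dom.
apply: ae_eq_integral => //.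
- by apply: emeasurable_funM => //; exact: measurable_int iRN.
- exact: emeasurable_funM.
apply: ae_eqe_mul2l; apply: integral_ae_eq => // E _ mE.
by rewrite -(Radon_Nikodym_SigmaFinite.f_integral dom mE).
Qed.

(** With [y = |z| / s] this is the [r]-th power of
    [y <= (1 + r) * (1 + y ^ 2 / (4 * r))], followed by [1 + x <= expR x]. *)
Lemma powR_le_expR (r s z : R) : 0 < r -> 0 < s ->
  `|z| `^ r <= ((1 + r) * s) `^ r * expR (z ^+ 2 / (s ^+ 2 *+ 4)).
Proof.
move=> r0 s0; set a := z ^+ 2 / _.
have -> : expR a = expR (a / r) `^ r.
  by rewrite -expRM ?divfK// gt_eqF.
rewrite -powRM ?expR_ge0//; last by rewrite mulr_ge0 ?addr_ge0 ?ltW.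
apply: ge0_ler_powR; rewrite ?nnegrE ?(ltW r0)//.
  by rewrite mulr_ge0 ?expR_ge0// mulr_ge0 ?addr_ge0 ?ltW.
apply: (@le_trans _ _ ((1 + r) * s * (1 + a / r))); last first.
  by apply: ler_wpM2l; [rewrite mulr_ge0 ?addr_ge0 ?ltW|exact: expR_ge1Dx].
have -> : a / r = (`|z| / s) ^+ 2 / (4 * r).
  rewrite /a exprMn real_normK ?num_real// exprVn -mulr_natr !invfM.
  by rewrite !mulrA.
set y := `|z| / s; have -> : `|z| = y * s by rewrite /y divfK// gt_eqF.
rewrite [leRHS]mulrAC ler_pM2r//.
have y0 : 0 <= y by rewrite divr_ge0// ltW.
have -> : (1 + r) * (1 + y ^+ 2 / (4 * r)) =
    (1 + r) * (4 * r + y ^+ 2) / (4 * r).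
  rewrite -mulrA; congr (_ * _); set w := 4 * r.
  by rewrite mulrDl mulfV// mulf_neq0 ?gt_eqF.
rewrite ler_pdivlMr ?mulr_gt0//; have := sqr_ge0 (y - 2 * r); nra.
Qed.

Definition gauss_moment_bound (r s : R) := (((1 + r) * s) `^ r * Num.sqrt 2)%R.

(** The factor [|z| ^ r] is absorbed by half of the exponent, which leaves a
    Gaussian density whose variance is doubled. *)
Lemma gaussian_moment (r s : R) : 0 < r -> 0 < s ->
  (\int[normal_prob 0 s]_z (`|z| `^ r)%:E <= (gauss_moment_bound r s)%:E)%E.
Proof.
move=> r0 s0; set K := gauss_moment_bound r s.
have s2 : 0 < Num.sqrt 2 * s by rewrite mulr_gt0// sqrtr_gt0.
rewrite integral_normal_prob//; last first.
  apply/measurable_EFinP; apply: (measurableT_comp (measurable_powR _)).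
  exact: normr_measurable.
apply: (@le_trans _ _ (\int[leb]_x (K%:E * (normal_pdf 0 (Num.sqrt 2 * s) x)%:E))%E).
  apply: le_integral_nonmeasurable => z.
    by rewrite -EFinM lee_fin mulr_ge0 ?powR_ge0 ?normal_pdf_ge0.
  rewrite -!EFinM lee_fin !normal_pdfE ?gt_eqF//.
  have peakE : normal_peak s = Num.sqrt 2 * normal_peak (Num.sqrt 2 * s).
    have E : (Num.sqrt 2 * s) ^+ 2 * pi *+ 2 = 2 * (s ^+ 2 * pi *+ 2).
      by rewrite exprMn sqr_sqrtr//; lra.
    by rewrite /normal_peak E sqrtrM// invfM mulrA mulfV ?mul1r//.
  set e := expR (- (z ^+ 2 / (s ^+ 2 *+ 4))).
  have fun1 : normal_fun 0 s z = e * e.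
    rewrite /normal_fun -expRD; congr expR; rewrite subr0 mulNr -opprD.
    rewrite (_ : s ^+ 2 *+ 4 = s ^+ 2 *+ 2 * 2); last by lra.
    by rewrite invfM mulrA; lra.
  have fun2 : normal_fun 0 (Num.sqrt 2 * s) z = e.
    rewrite /normal_fun; congr expR; rewrite subr0 exprMn sqr_sqrtr//.
    by rewrite mulNr (_ : 2 * s ^+ 2 *+ 2 = s ^+ 2 *+ 4)//; lra.
  rewrite fun1 fun2 peakE /K /gauss_moment_bound.
  have := powR_le_expR z r0 s0; rewrite -[X in _ <= _ * X]invrK -expRN -/e.
  have e0 : 0 < e by exact: expR_gt0.
  rewrite ler_pdivlMr// => h.
  set q := normal_peak _; have q0 : 0 <= q by exact: normal_peak_ge0.
  rewrite [leLHS](_ : _ = (`|z| `^ r * e) * (Num.sqrt 2 * q * e)); last by lra.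
  rewrite [leRHS](_ : _ = (((1 + r) * s) `^ r) * (Num.sqrt 2 * q * e)); last by lra.
  by apply: ler_wpM2r => //; rewrite !mulr_ge0 ?sqrtr_ge0 ?(ltW e0).
rewrite ge0_integralZl//; last 3 first.
- by apply/measurable_EFinP; exact: measurable_normal_pdf.
- by move=> x _; rewrite lee_fin normal_pdf_ge0.
- by rewrite lee_fin mulr_ge0 ?powR_ge0 ?sqrtr_ge0.
by rewrite integral_normal_pdf mule1.
Qed.

End gaussian_moments.

Section centred_gaussian_moments.
Context {R : realType}.
Context {d} {Omega : measurableType d} (P : probability Omega R).

(** The density is at most [normal_peak s], so that (-2, 2) has mass at most
    [4 * normal_peak s], and [z ^ 2 >= 4] outside of it. *)
Lemma normal_second_moment_ge (s : R) : 0 < s ->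
  ((4 * (1 - 4 * normal_peak s))%:E <= \int[normal_prob 0 s]_z (z ^+ 2)%:E)%E.
Proof.
move=> s0; set B : set R := `](-2), 2[%classic.
have mB : measurable B by exact: measurable_itv.
have PB : (normal_prob 0 s B <= (4 * normal_peak s)%:E)%E.
  rewrite /normal_prob.
  apply: (@le_trans _ _ (\int[lebesgue_measure]_(x in B) (normal_peak s)%:E)%E).
    apply: ge0_le_integral => //.
    - by move=> x _; rewrite lee_fin normal_pdf_ge0.
    - by apply: measurable_funTS; apply/measurable_EFinP; exact: measurable_normal_pdf.
    - by move=> x _; rewrite lee_fin normal_pdf_ub// gt_eqF.
  rewrite integral_cst//= /B lebesgue_measure_itv/= lte_fin.
  rewrite (_ : -2 < 2)//; last by lra.
  by rewrite -EFinD -EFinM lee_fin opprK mulrC; have := normal_peak_ge0 s; lra.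
have PBC : ((1 - 4 * normal_peak s)%:E <= normal_prob 0 s (~` B))%E.
  by rewrite probability_setC// EFinB leeB.
apply: (@le_trans _ _ (\int[normal_prob 0 s]_z (4 * \1_(~` B) z)%:E)%E).
  rewrite integral_indic_cst//; last exact: measurableC.
  by rewrite EFinM lee_pmul2l// lte_fin.
apply: le_integral_nonmeasurable => z; rewrite lee_fin.
  by rewrite mulr_ge0.
rewrite indicE; case: (boolP (z \in _)) => [/set_mem|_].
  rewrite /B/= in_itv/= mulr1 => /negP; rewrite negb_and -!leNgt => /orP[|] h; nra.
by rewrite mulr0 sqr_ge0.
Qed.

(** For large [s] the peak is small, and then the second moment exceeds 1. *)
Lemma normal_sd_le3 (s : R) : 0 < s ->
  (\int[normal_prob 0 s]_z (z ^+ 2)%:E <= 1)%E -> s <= 3.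
Proof.
move=> s0 /(le_trans (normal_second_moment_ge s0)); rewrite lee_fin => h.
rewrite leNgt; apply/negP => s3.
have : normal_peak s < 6^-1.
  have big : 6 ^+ 2 < s ^+ 2 * pi *+ 2 by have := pi_ge2 R; nra.
  have lt6 : 6 < Num.sqrt (s ^+ 2 * pi *+ 2).
    by rewrite -[ltLHS](ger0_norm (ler0n _ 6)) -sqrtr_sqr ltr_sqrt// (lt_trans _ big).
  by rewrite /normal_peak ltf_pV2 ?posrE// (lt_trans _ lt6).
lra.
Qed.

Lemma integral_centred_gaussian (Z : Omega -> R) (s : R) (f : R -> \bar R) :
  measurable_fun setT Z ->
  (forall B : set R, measurable B -> P (Z @^-1` B) = normal_prob 0 s B) ->
  measurable_fun setT f -> (forall x, 0 <= f x)%E ->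
  (\int[P]_w f (Z w) = \int[normal_prob 0 s]_z f z)%E.
Proof.
move=> mZ lawZ mf f0.
have := @ge0_integral_pushforward _ _ Omega (measurableTypeR R) R Z mZ P setT f measurableT mf
  (fun x _ => f0 x).
rewrite preimage_setT => <-.
pose Z' : {mfun Omega >-> measurableTypeR R} := HB.pack (Z : Omega -> measurableTypeR R)
  (isMeasurableFun.Build _ _ Omega (measurableTypeR R) Z mZ).
have := @eq_measure_integral _ _ R setT (normal_prob 0 s)
  (distribution P Z') f (fun B mB _ => lawZ B mB).
by move=> ->.
Qed.

(** The standard deviation is only known through the second moment, which
    bounds it by 3. *)
Lemma centred_gaussian_moment (Z : Omega -> R) (r : R) : 0 < r ->
  centred_gaussian P Z -> (\int[P]_w (Z w ^+ 2)%:E <= 1)%E ->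
  (\int[P]_w (`|Z w| `^ r)%:E <= (gauss_moment_bound r 3)%:E)%E.
Proof.
move=> r0 [mZ [s s0]]; case: ifPn => [_ Z0 _|sN0 lawZ].
  rewrite (@integral_ae0 _ _ _ P (fun w => (`|Z w| `^ r)%:E)).
  - by rewrite lee_fin mulr_ge0 ?powR_ge0 ?sqrtr_ge0.
  - by move=> w; rewrite lee_fin powR_ge0.
  - by apply: filterS Z0 => w /= ->; rewrite normr0 powR0// gt_eqF.
have {}s0 : 0 < s by rewrite lt0r sN0.
rewrite (integral_centred_gaussian mZ lawZ (f := fun z => (z ^+ 2)%:E)); first last.
- by move=> x; rewrite lee_fin sqr_ge0.
- by apply/measurable_EFinP; exact: measurable_funX.
move=> /(normal_sd_le3 s0) s3.
rewrite (integral_centred_gaussian mZ lawZ (f := fun z => (`|z| `^ r)%:E)); first last.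
- by move=> x; rewrite lee_fin powR_ge0.
- apply/measurable_EFinP; apply: (measurableT_comp (measurable_powR _)).
  exact: normr_measurable.
apply: le_trans (gaussian_moment r0 s0) _; rewrite lee_fin.
apply: ler_wpM2r; first exact: sqrtr_ge0.
apply: ge0_ler_powR; rewrite ?nnegrE ?mulr_ge0 ?addr_ge0 ?(ltW r0) ?(ltW s0)//.
by apply: ler_wpM2l => //; rewrite addr_ge0 ?(ltW r0).
Qed.

End centred_gaussian_moments.

(** * The gamma-norm of rank one operators *)

Section gamma_norm_rank_one.
Context {R : realType} {H : completeNormedModType R} (ip : H -> H -> R).
Context (p q : R) (p1 : 1 <= p) (q1 : 1 <= q).
Local Notation N := (@lplq_norm R p q).

Definition finite_support (x : seq2 R) : Prop :=
  exists n m, forall i j, ~~ ((i < n) && (j < m))%N -> x i j = 0.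

Definition rank_one (h : H) (x : seq2 R) : H -> seq2 R := fun g => ip g h *: x.

Let p0 : 0 < p. Proof. exact: lt_le_trans p1. Qed.
Let q0 : 0 < q. Proof. exact: lt_le_trans q1. Qed.

Lemma lplq_norm_fin (x : seq2 R) : finite_support x -> (N x < +oo)%E.
Proof. by move=> [n [m xs]]; rewrite (lplq_norm_finite_support p0 q0 xs) ltry. Qed.

Lemma lplq_normZ (a : R) (x : seq2 R) : finite_support x ->
  N (a *: x) = (`|a|%:E * N x)%E.
Proof.
move=> [n [m xs]].
have axs i j : ~~ ((i < n) && (j < m))%N -> (a *: x) i j = 0.
  by move=> /xs xij; rewrite (_ : (a *: x) i j = a * x i j)// xij mulr0.
rewrite (lplq_norm_finite_support p0 q0 xs) (lplq_norm_finite_support p0 q0 axs).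
rewrite -EFinM; congr (_%:E).
rewrite (eq_bigr (fun i : 'I_n => `|a| `^ p *
    (\sum_(j < m) `|x i j| `^ q) `^ (p / q))); last first.
  move=> i _; rewrite (eq_bigr (fun j : 'I_m => `|a| `^ q * `|x i j| `^ q)).
    have S0 : 0 <= \sum_(j < m) `|x i j| `^ q.
      by apply: sumr_ge0 => ? _; exact: powR_ge0.
    rewrite -mulr_sumr powRM ?powR_ge0//.
    by rewrite -powRrM mulrCA mulfV ?mulr1// gt_eqF.
  by move=> j _; rewrite (_ : (a *: x) i j = a * x i j)// normrM powRM.
have S0 : 0 <= \sum_(i < n) (\sum_(j < m) `|x i j| `^ q) `^ (p / q).
  by apply: sumr_ge0 => ? _; exact: powR_ge0.
rewrite -mulr_sumr powRM ?powR_ge0//.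
by rewrite -powRrM mulfV ?powRr1// gt_eqF.
Qed.

Lemma gamma_norm_fin_ge0 (u : H -> seq2 R) : (0 <= gamma_norm_fin ip N u)%E.
Proof. by apply: le_ereal_inf_tmp => _ [n [h [x [_ _ _ ->]]]]; exact: poweR_ge0. Qed.

Lemma gamma_norm_ge0 (u : H -> seq2 R) : (0 <= gamma_norm ip N u)%E.
Proof.
apply: le_ereal_inf_tmp => l [r [_ _ _ rl]].
apply: (cvge_to_ge rl); apply/nearW => m; exact: gamma_norm_fin_ge0.
Qed.

(** The single Gaussian variable in the definition contributes the square root
    of its second moment. *)
Lemma gamma_norm_fin_rank_one (h : H) (x : seq2 R) : ip h h = 1 ->
  finite_support x ->
  (gamma_norm_fin ip N (rank_one h x)
     <= (gauss_moment_bound 2 1 `^ 2^-1)%:E * N x)%E.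
Proof.
move=> h1 xs; have Nx := lplq_norm_fin xs; have Nx0 := lplq_norm_ge0 p q x.
have [a Na] : exists a, N x = a%:E by exists (fine (N x)); rewrite fineK// ge0_fin_numE.
have a0 : 0 <= a by rewrite -lee_fin -Na.
apply: (@le_trans _ _ (gaussianE 1 (fun g => N (\sum_(i < 1) g`_i *: x)%R ^+ 2)
              `^ (2^-1)%R)%E).
  apply: ereal_inf_lbound; exists 1%N, (fun=> h), (fun=> x); split => //.
  - by move=> i j; rewrite h1 !ord1 eqxx.
  - by apply/funext => g; rewrite /finite_rank big_ord1.
have E z : (N (\sum_(i < 1) [:: z]`_i *: x)%R ^+ 2 = (a ^+ 2)%:E * (z ^+ 2)%:E)%E.
  rewrite big_ord1/= lplq_normZ// Na -EFinM.
  by rewrite -expr2 exprMn real_normK ?num_real// mulrC EFinM.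
rewrite /gaussianE (eq_integral (fun z : measurableTypeR R =>
  (a ^+ 2)%:E * (z ^+ 2)%:E)%E); last first.
  by move=> z _; exact: E.
rewrite ge0_integralZl//; last 3 first.
- by apply/measurable_EFinP; exact: measurable_funX.
- by move=> z _; rewrite lee_fin sqr_ge0.
- by rewrite lee_fin sqr_ge0.
have K0 : 0 <= gauss_moment_bound 2 1 :> R.
  by rewrite mulr_ge0 ?powR_ge0 ?sqrtr_ge0.
apply: (@le_trans _ _ (((a ^+ 2)%:E * (gauss_moment_bound 2 1)%:E) `^ (2^-1))%E).
  have I0 : (0 <= \int[normal_prob 0 1]_z (z ^+ 2)%:E :> \bar R)%E.
    by apply: integral_ge0 => z _; rewrite lee_fin sqr_ge0.
  apply: gt0_ler_poweR => //.
  - by rewrite in_itv/= leey andbT mule_ge0// lee_fin sqr_ge0.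
  - by rewrite in_itv/= leey andbT mule_ge0// lee_fin sqr_ge0.
  apply: lee_wpmul2l; first by rewrite lee_fin sqr_ge0.
  apply: le_trans (gaussian_moment (ltr0n _ 2) ltr01).
  apply: le_integral_nonmeasurable => z; rewrite lee_fin ?sqr_ge0//.
  by rewrite powR_mulrn// real_normK ?num_real.
have aE : (a ^+ 2) `^ 2^-1 = a.
  by rewrite powR12_sqrt ?sqr_ge0// sqrtr_sqr ger0_norm.
by rewrite Na -!EFinM lee_fin powRM ?sqr_ge0// aE mulrC.
Qed.

Lemma rank_one0 h : rank_one h 0 = 0.
Proof. by apply/funext => g; rewrite /rank_one scaler0. Qed.

Lemma finite_support0 : finite_support 0.
Proof. by exists 0%N, 0%N. Qed.

Lemma gamma_norm_rank_one (h : H) (x : seq2 R) : ip h h = 1 ->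
  finite_support x ->
  (gamma_norm ip N (rank_one h x)
     <= (gauss_moment_bound 2 1 `^ 2^-1)%:E * N x)%E.
Proof.
move=> h1 xs; have fin := gamma_norm_fin_rank_one h1 xs.
apply: le_trans fin; apply: ereal_inf_lbound.
have N0 : N 0 = 0%E by exact: lplq_norm0.
exists (fun=> rank_one h x); split.
- move=> m; apply: le_lt_trans (gamma_norm_fin_rank_one h1 xs) _.
  by apply: lte_mul_pinfty; rewrite ?lee_fin ?powR_ge0//; exact: lplq_norm_fin.
- move=> e e0; exists 0%N => m n _ _; rewrite subrr -(rank_one0 h).
  apply: le_lt_trans (gamma_norm_fin_rank_one h1 finite_support0) _.
  by rewrite N0 mule0 lte_fin.
- by move=> g; under eq_fun do rewrite subrr N0; exact: cvg_cst.
- exact: cvg_cst.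
Qed.

Lemma gamma_norm0 (h : H) : ip h h = 1 -> gamma_norm ip N (0 : H -> seq2 R) = 0%E.
Proof.
move=> h1; apply/eqP; rewrite eq_le gamma_norm_ge0 andbT -(rank_one0 h).
apply: le_trans (gamma_norm_rank_one h1 finite_support0) _.
by rewrite lplq_norm0// mule0.
Qed.

End gamma_norm_rank_one.

(** * Jointly measurable versions *)

Section measurable_version.
Context {R : realType} {d} {Omega : measurableType d} (P : probability Omega R).

Lemma measurable_truncn_preimage (k : nat) :
  measurable ((fun t : R => Num.truncn t) @^-1` [set k]).
Proof.
have -> : (fun t : R => Num.truncn t) @^-1` [set k] =
    if k is 0%N then `]-oo, 1[%classic else `[k%:R, k.+1%:R[%classic.
  case: k => [|k]; apply/seteqP; split => t /=; rewrite in_itv/=.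
  - have [t0 tk|t0 _] := leP 0 t; last by rewrite (lt_trans t0).
    by have := truncn_itv t0; rewrite tk => /andP[_].
  - move=> t1; have [t0|t0] := leP 0 t; first by apply: truncn_def; rewrite t0.
    by apply/truncn0Pn; rewrite -ltNge (lt_trans t0).
  - have [t0 <-|t0] := leP 0 t; first exact: truncn_itv.
    have -> : Num.truncn t = 0%N by apply/truncn0Pn; rewrite -ltNge (lt_trans t0).
    by [].
  - exact: truncn_def.
by case: k => [|k]; exact: measurable_itv.
Qed.

(** Preimages are countable unions of measurable rectangles. *)
Lemma measurable_fun_nat_index d1 d2 (T1 : measurableType d1)
    (T2 : measurableType d2) (kappa : T1 -> nat) (g : nat -> T2 -> R) :
  (forall k, measurable (kappa @^-1` [set k])) ->
  (forall k, measurable_fun setT (g k)) ->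
  measurable_fun setT (fun z : T1 * T2 => g (kappa z.1) z.2).
Proof.
move=> mk mg _ Y mY; rewrite setTI.
have -> : (fun z : T1 * T2 => g (kappa z.1) z.2) @^-1` Y =
    \bigcup_k (kappa @^-1` [set k] `*` g k @^-1` Y).
  apply/seteqP; split => [z /= Yz|z [k _ [/= <-]]//].
  by exists (kappa z.1).
apply: bigcup_measurable => k _; apply: measurableX; first exact: mk.
by rewrite -[X in measurable X]setTI; exact: mg.
Qed.

Definition dyadic_floor (m : nat) (t : R) : R := (Num.truncn (t * 2 ^+ m))%:R / 2 ^+ m.

Lemma dyadic_floor_itv m t : 0 <= t ->
  [/\ 0 <= dyadic_floor m t, dyadic_floor m t <= t & t - dyadic_floor m t <= (2 ^+ m)^-1].
Proof.
move=> t0; have p0 : 0 < 2 ^+ m :> R by rewrite exprn_gt0.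
have /andP[h1 h2] := truncn_itv (mulr_ge0 t0 (ltW p0)).
split; first by rewrite divr_ge0// ltW.
  by rewrite ler_pdivrMr.
rewrite lerBlDr /dyadic_floor -[X in _ <= X + _]mul1r -mulrDl ler_pdivlMr//.
by rewrite addrC natr1 ltW.
Qed.

(** The upper limit makes the function measurable without any knowledge of
    convergence. *)
Definition dyadic_limit (B : R -> Omega -> R) (z : R * Omega) : R :=
  fine (limn_esup (fun m => (B (dyadic_floor m z.1) z.2)%:E)).

Lemma measurable_dyadic_limit (B : R -> Omega -> R) :
  (forall t, 0 <= t -> measurable_fun setT (B t)) ->
  measurable_fun [set: measurableTypeR R * Omega] (dyadic_limit B).
Proof.
move=> mB; apply: measurableT_comp; first exact: fine_measurable.
apply: measurable_fun_limn_esup => m; apply/measurable_EFinP.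
apply: (@measurable_fun_nat_index _ _ (measurableTypeR R) Omega
  (fun t => Num.truncn (t * 2 ^+ m)) (fun k => B (k%:R / 2 ^+ m))).
  move=> k; have mm : measurable_fun [set: measurableTypeR R] (fun t : R => t * 2 ^+ m).
    exact: measurable_funM.
  rewrite -[X in measurable X]setTI.
  exact: (mm measurableT _ (measurable_truncn_preimage k)).
by move=> k; apply: mB; rewrite divr_ge0.
Qed.

Lemma cvg_of_nneseries_sqr (a : nat -> R) (l : R) :
  (\sum_(m <oo) ((a m - l) ^+ 2)%:E < +oo)%E -> a m @[m --> \oo] --> l.
Proof.
move=> suma.
have sq0 : ((a m - l) ^+ 2)%:E @[m --> \oo] --> 0%E.
  apply: (@squeeze_cvge _ _ _ _ (fun=> 0%E) _
    (fun N => \sum_(N <= k <oo) ((a k - l) ^+ 2)%:E)%E).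
  - apply/nearW => m; rewrite lee_fin sqr_ge0/= (@nneseries_split _ _ m 1) => [|k _].
      by rewrite addn1 big_nat1 leeDl// nneseries_ge0// => k _; rewrite lee_fin sqr_ge0.
    by rewrite lee_fin sqr_ge0.
  - exact: cvg_cst.
  - by apply: nneseries_tail_cvg => // k _; rewrite lee_fin sqr_ge0.
have {}sq0 : (a m - l) ^+ 2 @[m --> \oo] --> 0 by have /fine_cvgP[_] := sq0.
apply/cvgrPdist_lt => e e0.
have sqe0 : 0 < e ^+ 2 by exact: exprn_gt0.
move/cvgrPdist_lt : sq0 => /(_ _ sqe0). apply: filterS => m /=.
by rewrite sub0r normrN normrX ltr_pXn2r// ?nnegrE ?(ltW e0)// distrC.
Qed.

(** The squared L^2 distances between [B t] and its values along the dyadic grid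
    have a finite sum, so that almost surely the squared distances tend to 0. *)
Lemma dyadic_limit_ae (B : R -> Omega -> R) :
  (forall t, 0 <= t -> measurable_fun setT (B t)) ->
  (forall s t : R, 0 <= s -> s <= t ->
     (\int[P]_w ((B s w - B t w) ^+ 2)%:E = (t - s)%:E)%E) ->
  forall t, 0 <= t -> {ae P, forall w, dyadic_limit B (t, w) = B t w}.
Proof.
move=> mB BB t t0.
pose f m w := ((B (dyadic_floor m t) w - B t w) ^+ 2)%:E.
have mf m : measurable_fun setT (f m).
  apply/measurable_EFinP; apply: measurable_funX; apply: measurable_funB; apply: mB => //.
  by have [] := dyadic_floor_itv m t0.
have f0 m w : (0 <= f m w)%E by rewrite lee_fin sqr_ge0.
have intf : (\int[P]_w (\sum_(m <oo) f m w) < +oo)%E.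
  rewrite integral_nneseries//.
  apply: (@le_lt_trans _ _ (\sum_(m <oo) ((2 ^+ m)^-1)%:E)%E).
    apply: lee_nneseries => [m *|m *]; first by apply: integral_ge0 => w _; exact: f0.
    have [k0 kt tk] := dyadic_floor_itv m t0.
    by rewrite /f BB// lee_fin.
  apply: (@le_lt_trans _ _ 2%:E); last exact: ltry.
  apply: le_trans (epsilon_trick0 xpredT (ler0n R 2)).
  apply: lee_nneseries => m *; rewrite lee_fin ?invr_ge0 ?exprn_ge0//.
  by rewrite expnS natrM invfM mulrA mulfV// mul1r natrX.
have : P.-integrable setT (fun w => \sum_(m <oo) f m w)%E.
  apply/integrableP; split.
    exact: ge0_emeasurable_sum.
  by under eq_integral do rewrite gee0_abs ?nneseries_ge0//.
move=> /integrable_ae => /(_ measurableT); apply: filterS => w /(_ I) fin.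
have /cvg_of_nneseries_sqr cvgB : (\sum_(m <oo) f m w < +oo)%E.
  by rewrite -ge0_fin_numE// nneseries_ge0.
rewrite /dyadic_limit/= (cvg_limn_einf_sup (_ : _ --> (B t w)%:E)).2//.
by apply: cvg_EFin; [exact/nearW|exact: cvgB].
Qed.

End measurable_version.

(** * The Brownian motion in a fixed direction *)

Section brownian_increments.
Context {R : realType} {H : completeNormedModType R} (ip : H -> H -> R).
Context {d} {Omega : measurableType d} (P : probability Omega R).
Variables (F : R -> set (set Omega)) (W : (R -> H) -> Omega -> R).
Hypothesis ipP : is_inner_product ip.
Hypothesis WP : is_cylindrical_BM ip P F W.
Variable h : H.
Hypothesis h1 : ip h h = 1.

Definition step_vector (a b : R) : R -> H := fun s => \1_(`]a, b]) s *: h.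

Lemma L2H_step_vector (a b : R) : 0 <= a -> a <= b -> L2H (step_vector a b).
Proof.
move=> a0 ab.
have mab : measurable (`]a, b]%classic : set (measurableTypeR R)).
  exact: measurable_itv.
split.
  exists (fun=> step_vector a b); split.
    move=> m; have [ff mf] := finitely_valued_comp (fun x : R => x *: h)
      (finitely_valued_indic (R := R) mab).
    by split => // t; rewrite /hilbert_norm ltry.
  apply/nearW => t; under eq_fun do rewrite subrr /hilbert_norm normr0.
  exact: cvg_cst.
apply: (@le_lt_trans _ _ (`|h|%:E * leb_plus `]a, b]%classic `^ 2^-1)%E).
  apply: Lnorm_le_on => //= t.
    rewrite in_itv/= => tab; rewrite /hilbert_norm/= lee_fin normr_id.
    by rewrite /step_vector indicE mem_set ?scale1r.
  move=> tab; rewrite /hilbert_norm /step_vector indicE memNset//.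
  by rewrite scale0r normr0.
by rewrite leb_plus_itvoc// poweR_EFin -EFinM ltry.
Qed.

Lemma ip0 : ip 0 0 = 0.
Proof. by have [_ _ ipE] := ipP; rewrite -ipE normr0 expr0n. Qed.

(** The isometry of [W] on a multiple of the unit vector [h]. *)
Lemma integral_sqr_W (a b : R) : 0 <= a -> a <= b ->
  (\int[P]_w (W (step_vector a b) w ^+ 2)%:E = (b - a)%:E)%E.
Proof.
move=> a0 ab; have [_ _ cov _] := WP; have L := L2H_step_vector a0 ab.
have := cov _ _ L L; rewrite unlock => E.
transitivity (\int[leb_plus]_t (1 * \1_(`]a, b]) t)%:E)%E; last first.
  by rewrite integral_indic_cst// leb_plus_itvoc// mul1e.
transitivity (\int[leb_plus]_t (ip (step_vector a b t) (step_vector a b t))%:E)%E.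
  by rewrite -E; apply: eq_integral => w _; rewrite expr2.
apply: eq_integral => t _; rewrite /step_vector indicE.
by case: (_ \in _); rewrite ?scale1r ?scale0r ?h1 ?ip0 mul1r.
Qed.

Lemma measurable_W (a b : R) : 0 <= a -> a <= b ->
  measurable_fun setT (W (step_vector a b)).
Proof.
move=> a0 ab; have [_ gauss _ _] := WP.
by have [] := gauss _ (L2H_step_vector a0 ab).
Qed.

Definition brownian (t : R) : Omega -> R := W (step_vector 0 t).

Lemma brownian_increment (a b : R) : 0 <= a -> a <= b ->
  {ae P, forall w, brownian b w - brownian a w = W (step_vector a b) w}.
Proof.
move=> a0 ab; have [[_ lin _] _ _ _] := WP.
have La := L2H_step_vector (lexx 0) a0.
have Lb := L2H_step_vector (lexx 0) (le_trans a0 ab).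
have := lin (-1) _ _ La Lb; apply: filterS => w.
have -> : -1 *: step_vector 0 a + step_vector 0 b = step_vector a b.
  apply/funext => t.
  rewrite (_ : (_ + _) t = -1 *: step_vector 0 a t + step_vector 0 b t)//.
  rewrite /step_vector scalerA -scalerDl; congr (_ *: _).
  rewrite !indicE !mem_setE/= !in_itv/=.
  have [ta|ta] := leP t a.
    by rewrite (le_trans ta ab) andbT; case: (0 < t); rewrite /=; lra.
  by rewrite (le_lt_trans a0 ta)/=; lra.
by move=> ->; rewrite /brownian; lra.
Qed.

Lemma measurable_brownian t : 0 <= t -> measurable_fun setT (brownian t).
Proof. by move=> t0; exact: measurable_W. Qed.

Lemma integral_brownian_increment (s t : R) : 0 <= s -> s <= t ->
  (\int[P]_w ((brownian s w - brownian t w) ^+ 2)%:E = (t - s)%:E)%E.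
Proof.
move=> s0 st; have t0 := le_trans s0 st.
rewrite -(integral_sqr_W s0 st); apply: ge0_ae_eq_integral => //.
- apply/measurable_EFinP; apply: measurable_funX.
  by apply: measurable_funB; exact: measurable_brownian.
- apply/measurable_EFinP; apply: measurable_funX; exact: measurable_W.
- by move=> w _; rewrite lee_fin sqr_ge0.
- by move=> w _; rewrite lee_fin sqr_ge0.
have := brownian_increment s0 st; apply: filterS => w <- _.
by congr (_%:E); lra.
Qed.

(** A modification of [brownian], jointly measurable because time is discretised. *)
Definition brownian_version : R * Omega -> R := dyadic_limit brownian.

Lemma measurable_brownian_version :
  measurable_fun [set: measurableTypeR R * Omega] brownian_version.
Proof. by apply: measurable_dyadic_limit => t; exact: measurable_brownian. Qed.

Lemma brownian_version_increment (a b : R) : 0 <= a -> a <= b ->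
  {ae P, forall w, brownian_version (b, w) - brownian_version (a, w) =
                   W (step_vector a b) w}.
Proof.
move=> a0 ab; have b0 := le_trans a0 ab.
have vers := dyadic_limit_ae measurable_brownian integral_brownian_increment.
have va := vers _ a0; have vb := vers _ b0.
have inc := brownian_increment a0 ab.
by apply: filterS3 va vb inc => w; rewrite /brownian_version => -> -> ->.
Qed.

Lemma measurable_brownian_version_increment (a b : R) :
  measurable_fun setT (fun w => brownian_version (b, w) - brownian_version (a, w)).
Proof.
have m c : measurable_fun setT (fun w => brownian_version (c, w)).
  exact: (measurableT_comp measurable_brownian_version
    (measurable_pair1 (c : measurableTypeR R))).
by apply: measurable_funB; exact: m.
Qed.

Lemma brownian_version_moment (r a b : R) : 0 < r -> 0 <= a -> a <= b -> b - a <= 1 ->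
  (\int[P]_w (`|brownian_version (b, w) - brownian_version (a, w)| `^ r)%:E
     <= (gauss_moment_bound r 3)%:E)%E.
Proof.
move=> r0 a0 ab ba1; have [_ gauss _ _] := WP.
have G := gauss _ (L2H_step_vector a0 ab).
have m (f : Omega -> R) : measurable_fun setT f ->
    measurable_fun setT (fun w => (`|f w| `^ r)%:E).
  move=> mf; apply/measurable_EFinP; apply: (measurableT_comp (measurable_powR _)).
  exact: measurableT_comp.
apply: le_trans (centred_gaussian_moment r0 G _); last first.
  by rewrite integral_sqr_W// lee_fin.
rewrite le_eqVlt; apply/orP; left; apply/eqP; apply: ge0_ae_eq_integral => //.
- apply: m; exact: measurable_brownian_version_increment.
- apply: m; exact: measurable_W.
have := brownian_version_increment a0 ab; apply: filterS => w /= wE _.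
by rewrite wE.
Qed.

Lemma brownian_version_variance (a b : R) : 0 <= a -> a <= b ->
  (\int[P]_w ((brownian_version (b, w) - brownian_version (a, w)) ^+ 2)%:E
     = (b - a)%:E)%E.
Proof.
move=> a0 ab; rewrite -(integral_sqr_W a0 ab); apply: ge0_ae_eq_integral => //.
- apply/measurable_EFinP; apply: measurable_funX.
  exact: measurable_brownian_version_increment.
- apply/measurable_EFinP; apply: measurable_funX; exact: measurable_W.
- by move=> w _; rewrite lee_fin sqr_ge0.
- by move=> w _; rewrite lee_fin sqr_ge0.
have := brownian_version_increment a0 ab; apply: filterS => w /= wE _.
by rewrite wE.
Qed.

End brownian_increments.

(** * The product of time and probability *)

Section product_measure_lemmas.
Context {R : realType} {d} {Omega : measurableType d} (P : probability Omega R).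

Lemma leb_on_cylinder (I : interval R) (a b : R) : a <= b ->
  ((leb_on I \x P) (`]a, b]%classic `*` setT) <= (b - a)%:E)%E.
Proof.
move=> ab; rewrite product_measure1E//.
rewrite [X in (_ * X)%E]probability_setT mule1.
apply: (@le_trans _ _ (lebesgue_measure `]a, b]%classic)).
  by apply: measureIl; exact: measurable_itv.
rewrite lebesgue_measure_itv/= lte_fin; case: ltP => // ba.
by rewrite lee_fin subr_ge0.
Qed.

Lemma leb_plus_cylinder (a b : R) : 0 <= a -> a <= b ->
  ((leb_plus \x P) (`]a, b]%classic `*` setT) = (b - a)%:E)%E.
Proof.
move=> a0 ab; rewrite product_measure1E//.
by rewrite [X in (_ * X)%E]probability_setT mule1 leb_plus_itvoc.
Qed.

Lemma sigma_finite_leb_plus : sigma_finite setT (@leb_plus R).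
Proof.
have /sigma_finiteP[F [FT _ Ffin]] := @sigma_finiteT _ _ _ (@lebesgue_measure R).
exists F => // k; have [mF Fk] := Ffin k; split => //.
by apply: le_lt_trans Fk; exact: measureIl.
Qed.

Lemma integral_leb_plus_prod (f : R * Omega -> \bar R) :
  measurable_fun [set: measurableTypeR R * Omega] f -> (forall z, 0 <= f z)%E ->
  (\int[leb_plus \x P]_z f z = \int[leb_plus]_t \int[P]_w f (t, w))%E.
Proof.
move=> mf f0.
(* The product measure depends on the underlying set function alone, so that it
   does not change when [leb_plus] is equipped with its sigma-finiteness. *)
pose m1 : {sigma_finite_measure set (measurableTypeR R) -> \bar R} :=
  HB.pack (Measure.sort (@leb_plus R))
    (Measure_isSigmaFinite.Build _ _ _ (@leb_plus R) sigma_finite_leb_plus).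
exact: (@fubini_tonelli1 _ _ _ _ R m1 P f mf f0).
Qed.

Lemma Lp_norm_ae0 {d'} {T : measurableType d'} (mu : {measure set T -> \bar R})
    {V : lmodType R} (N : V -> \bar R) (p : R) (f : T -> V) : 0 < p ->
  {ae mu, forall t, N (f t) = 0%E} -> Lp_norm N mu p f = 0%E.
Proof.
move=> p0 f0; rewrite /Lp_norm unlock.
rewrite integral_ae0 ?poweR0r ?invr_neq0 ?gt_eqF//.
- by move=> t; exact: poweR_ge0.
- by apply: filterS f0 => t /= ->; rewrite abse0 poweR0r// gt_eqF.
Qed.

End product_measure_lemmas.

(** * Step processes with values in a single column *)

Section rank_one_processes.
Context {R : realType} {H : completeNormedModType R} (ip : H -> H -> R).
Context (p q : R) (p1 : 1 <= p) (q1 : 1 <= q).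
Local Notation N := (@lplq_norm R p q).
Local Notation K := (gauss_moment_bound (2 : R) 1 `^ 2^-1).
Variables (h : H) (h1 : ip h h = 1).

Lemma finite_support_column n j a : finite_support (column n j a : seq2 R).
Proof.
exists n, j.+1 => i' j'; rewrite /column; case: (ltnP i' n) => //= _.
by case: eqP => // ->; rewrite ltnSn.
Qed.

(** Such a function is itself simple, its values being images of the values of
    [phi]; only its norm has to be bounded. *)
Lemma Lp_space_rank_one_column {d} {T : measurableType d}
    (mu : {measure set T -> \bar R}) (r c : R) (D : set T) n j
    (phi : nat -> T -> R) :
  0 < r -> 0 <= c -> measurable D -> (mu D < +oo)%E ->
  (forall i, finitely_valued (phi i)) -> (forall i t, `|phi i t| <= c) ->
  (forall i t, (i < n)%N -> ~ D t -> phi i t = 0) ->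
  Lp_space (gamma_norm ip N) mu r (fun t => rank_one ip h (column n j (phi^~ t))).
Proof.
move=> r0 c0 mD Doo fphi phic phi0.
have Nle t : (N (column n j (phi^~ t)) <= (n%:R * c)%:E)%E.
  apply: le_trans (lplq_norm_column_le _ _ _ p1 q1) _; rewrite lee_fin.
  have -> : n%:R * c = \sum_(i < n) c by rewrite sumr_const card_ord mulr_natl.
  by apply: ler_sum => i _; exact: phic.
have gle t : (gamma_norm ip N (rank_one ip h (column n j (phi^~ t)))
    <= (K * (n%:R * c))%:E)%E.
  apply: le_trans (gamma_norm_rank_one p1 q1 h1 (finite_support_column _ _ _)) _.
  by rewrite EFinM; apply: lee_wpmul2l => //; rewrite lee_fin powR_ge0.
have nc0 : 0 <= K * (n%:R * c) by rewrite !mulr_ge0// powR_ge0.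
split.
  exists (fun=> fun t => rank_one ip h (column n j (phi^~ t))); split.
    move=> m.
    have [ff mf] := finitely_valued_comp (rank_one ip h) (finitely_valued_column n j fphi).
    by split => // t; apply: le_lt_trans (gle t) _; exact: ltry.
  apply/nearW => t; under eq_fun do rewrite subrr (gamma_norm0 p1 q1 h1).
  exact: cvg_cst.
apply: (@le_lt_trans _ _ ((K * (n%:R * c))%:E * mu D `^ r^-1)%E).
  apply: Lnorm_le_on => //= t Dt; first by rewrite gee0_abs ?gamma_norm_ge0.
  rewrite (_ : column n j _ = 0) ?rank_one0 ?(gamma_norm0 p1 q1 h1)//.
  apply/funext => i'; apply/funext => j'; rewrite /column.
  by case: ifP => // /andP[i'n _]; exact: phi0.
apply: lte_mul_pinfty => //.
exact: poweR_lty.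
Qed.

Definition unit_entry (i j : nat) : seq2 R := column i.+1 j (fun k => (k == i)%:R).

Context {d} {Omega : measurableType d} (P : probability Omega R).
Variables (F : R -> set (set Omega)) (W : (R -> H) -> Omega -> R).

(** Intervals that are empty are dropped, because an elementary process requires
    [a < b]. *)
Definition rank_one_steps n j (c : R) (a b : nat -> R) :
    seq (@elementary R H _ Omega (seq2 R)) :=
  [seq Elementary (a i) (b i) setT h (c *: unit_entry i j) |
    i <- iota 0 n & a i < b i].

Lemma rank_one_column n j (a : nat -> R) g :
  rank_one ip h (column n j a) g =
  \sum_(i < n) (a i * ip g h) *: unit_entry i j.
Proof.
rewrite /rank_one column_sum scaler_sumr; apply: eq_bigr => i _.
by rewrite scalerA mulrC.
Qed.


Lemma step_process_rank_one_steps n j c a b :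
  step_process ip (rank_one_steps n j c a b) =
  fun z => rank_one ip h (column n j (fun i => c * \1_(`]a i, b i]) z.1)).
Proof.
apply/funext => z; apply/funext => g; rewrite rank_one_column /step_process.
rewrite /rank_one_steps big_map big_filter -(subn0 n) -/(index_iota 0 n).
rewrite big_mkord big_mkcond/= subn0; apply: eq_bigr => i _.
case: ifPn => [ab|]; first by rewrite indicT mulr1 scalerA mulrAC [_ * c]mulrC.
rewrite -leNgt => ba; rewrite [\1_(`]a i, b i]) _]indicE memNset.
  by rewrite mulr0 mul0r scale0r.
by rewrite /= in_itv/= => /andP[az zb]; have := lt_le_trans az (le_trans zb ba); rewrite ltxx.
Qed.

Lemma adapted_rank_one_steps n j c a b :
  is_filtration F -> (forall i, (i < n)%N -> 0 <= a i) ->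
  adapted_step N F (rank_one_steps n j c a b).
Proof.
move=> [filtr _] a0 k; rewrite size_map => kn.
rewrite (nth_map 0%N)//; set i := nth _ _ _.
have : i \in [seq i <- iota 0 n | a i < b i] by exact: mem_nth.
rewrite mem_filter mem_iota add0n /= => /andP[ab i_n].
split => //=; first exact: a0.
  have [sF _] := filtr _ (a0 _ i_n).
  by have [F0 FC _] := sF; have := FC _ F0; rewrite setD0.
rewrite (lplq_normZ p1 q1); last exact: finite_support_column.
by apply: lte_mul_pinfty => //; apply: lplq_norm_fin => //; exact: finite_support_column.
Qed.

Lemma step_integral_rank_one_steps n j c a b t :
  (forall i, (i < n)%N -> a i < b i -> b i <= t) ->
  step_integral W (rank_one_steps n j c a b) t =
  fun w => column n j (fun i =>
    if a i < b i then c * W (step_vector h (a i) (b i)) w else 0).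
Proof.
move=> bt; apply/funext => w; rewrite column_sum /step_integral.
rewrite /rank_one_steps big_map big_filter -(subn0 n) -/(index_iota 0 n).
rewrite big_mkord big_mkcond/= subn0; apply: eq_bigr => i _.
case: ifPn => [ab|_]; last by rewrite scale0r.
have bit := bt _ (ltn_ord i) ab; have ait := le_trans (ltW ab) bit.
rewrite indicT mul1r scalerA mulrC; congr ((_ * _) *: _); congr W.
by rewrite /step_vector min_l// min_l.
Qed.

End rank_one_processes.

(** * Cutting a moving window with a cell *)

Section clamp.
Context {R : realType}.

(** The point of the closure of the cell [i] that is closest to [t]. *)
Definition clamp (i : nat) (t : R) : R := Num.max i%:R (Num.min i.+1%:R t).

Lemma clamp_ge i t : i%:R <= clamp i t.
Proof. by rewrite /clamp le_max lexx. Qed.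

Lemma clamp_le i t : clamp i t <= i.+1%:R.
Proof. by rewrite /clamp ge_max ler_nat leqnSn/= ge_min lexx. Qed.

Lemma clamp_ge0 i t : 0 <= clamp i t.
Proof. exact: le_trans (clamp_ge i t). Qed.

Lemma clamp_small i t : t <= i%:R -> clamp i t = i%:R.
Proof. by move=> ti; rewrite /clamp max_l// ge_min ti orbT. Qed.

Lemma clamp_large i t : i.+1%:R <= t -> clamp i t = i.+1%:R.
Proof. by move=> it; rewrite /clamp min_l// max_r// ler_nat. Qed.

Lemma le_clamp i s t : s <= t -> clamp i s <= clamp i t.
Proof.
move=> st; rewrite /clamp ge_max le_max lexx/= le_max; apply/orP; right.
by rewrite le_min !ge_min lexx/= st orbT.
Qed.

Lemma clamp_increment i s t : clamp i t - clamp i s <= 1.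
Proof.
have := clamp_le i t; have := clamp_ge i s; rewrite -natr1; lra.
Qed.

(** A non-empty intersection of a cell with the past of [t] ends at or before
    [t], so that stopping the stochastic integral at [t] leaves it unchanged. *)
Lemma clamp_le_of_lt i s t : clamp i s < clamp i t -> clamp i t <= t.
Proof.
move=> st; have := le_lt_trans (clamp_ge i s) st.
by rewrite /clamp lt_max ltxx/= => /ltW/max_r ->; rewrite ge_min lexx orbT.
Qed.

(** The window (t - d, t] meets the cell [i] in the interval between the clamped
    end points, including the case of an empty intersection. *)
Lemma indic_clamp i (t d s : R) :
  \1_(`]clamp i (t - d), clamp i t]) s = \1_(`[0, d[) (t - s) * \1_(cell i) s :> R.
Proof.
rewrite !indicE -natrM mulnb; congr ((nat_of_bool _)%:R).
rewrite mem_cell !mem_setE/= !in_itv/= /clamp.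
apply/idP/idP.
  rewrite gt_max gt_min => /andP[/andP[h3 h5]].
  rewrite le_max leNgt h3/= le_min => /andP[h4 h1].
  move: h5; rewrite ltNge h4/= => h2.
  by rewrite andbT; apply/andP; split; lra.
move=> /andP[/andP[h1 h2] /andP[h3 h4]]; apply/andP; split.
  by rewrite gt_max h3/= gt_min; apply/orP; right; lra.
by rewrite le_max le_min h4/=; apply/orP; right; lra.
Qed.

Lemma measurable_clamp i : measurable_fun setT (clamp i).
Proof. by apply: measurable_maxr => //; exact: measurable_minr. Qed.

End clamp.

Lemma finitely_valued_precomp {d1 d2} {T1 : measurableType d1}
    {T2 : measurableType d2} {A : Type} (g : T1 -> T2) (f : T2 -> A) :
  measurable_fun setT g -> finitely_valued f -> finitely_valued (fun t => f (g t)).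
Proof.
move=> mg [ff mf]; split.
  by apply: sub_finite_set ff => _ [t _ <-]; exists (g t).
by move=> a; rewrite -[X in measurable X]setTI; exact: (mg measurableT _ (mf a)).
Qed.

(** * Stochastic convolutions with box kernels *)

Section stochastic_convolution.
Context {R : realType} {H : completeNormedModType R} (ip : H -> H -> R).
Context {d} {Omega : measurableType d} (P : probability Omega R).
Variables (F : R -> set (set Omega)) (W : (R -> H) -> Omega -> R).
Hypothesis ipP : is_inner_product ip.
Hypothesis FP : is_filtration F.
Hypothesis WP : is_cylindrical_BM ip P F W.
Variables (h : H) (h1 : ip h h = 1).
Context (q1 q2 : R) (q11 : 1 <= q1) (q21 : 1 <= q2).
Local Notation N := (@lplq_norm R q1 q2).
Local Notation Bv := (brownian_version W h).

Variables (c delta : R) (c0 : 0 <= c) (delta0 : 0 < delta).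

Definition scaled_box (t : R) : R := c * \1_(`[0, delta[) t.

Definition cell_steps (n j : nat) : seq (@elementary R H _ Omega (seq2 R)) :=
  rank_one_steps h n j 1 (fun i => i%:R) (fun i => i.+1%:R).

(** The stochastic integral of the moving window over the cell [i]. *)
Definition conv_coef (i : nat) (z : R * Omega) : R :=
  c * (Bv (clamp i z.1, z.2) - Bv (clamp i (z.1 - delta), z.2)).

Definition conv_process (n j : nat) (z : R * Omega) : seq2 R :=
  column n j (fun i => conv_coef i z).

Lemma measurable_conv_coef i :
  measurable_fun [set: measurableTypeR R * Omega] (conv_coef i).
Proof.
have m (g : R -> R) : measurable_fun setT g ->
    measurable_fun [set: measurableTypeR R * Omega] (fun z => Bv (g z.1, z.2)).
  move=> mg.
  have mp : measurable_fun [set: measurableTypeR R * Omega]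
      (fun z => (g z.1, z.2) : measurableTypeR R * Omega).
    apply: measurable_fun_pair => //.
    exact: (measurableT_comp mg (@measurable_fst _ _ (measurableTypeR R) Omega)).
  exact: (measurableT_comp (measurable_brownian_version WP h) mp).
have mc : measurable_fun setT (fun t : R => clamp i (t - delta)).
  apply: measurableT_comp; first exact: measurable_clamp.
  exact: measurable_funB.
apply: measurable_funM => //; apply: measurable_funB.
  exact: (m (clamp i) (measurable_clamp i)).
exact: (m _ mc).
Qed.

(** The increments are Gaussian of variance at most 1, and they vanish when the
    moving window meets none of the cells. *)
Lemma conv_coef_moment (r t : R) n i : 0 < r -> (i < n)%N ->
  (\int[P]_w (`|conv_coef i (t, w)| `^ r)%:E
    <= ((c `^ r * gauss_moment_bound r 3) * \1_(`]0%R, n%:R + delta]) t)%:E)%E.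
Proof.
move=> r0 i_n; have G0 : 0 <= gauss_moment_bound r 3 :> R.
  by rewrite mulr_ge0 ?powR_ge0 ?sqrtr_ge0.
have [tD|tD] := boolP (t \in `]0%R, n%:R + delta]%classic).
  rewrite indicE tD mulr1.
  have ds : clamp i (t - delta) <= clamp i t.
    by apply: le_clamp; rewrite gerBl ltW.
  pose D w := Bv (clamp i t, w) - Bv (clamp i (t - delta), w).
  have mD : measurable_fun setT D.
    exact: (measurable_brownian_version_increment WP h (clamp i (t - delta)) (clamp i t)).
  rewrite (eq_integral (fun w => (c `^ r)%:E * (`|D w| `^ r)%:E)%E); last first.
    by move=> w _; rewrite /conv_coef normrM (ger0_norm c0) powRM// EFinM.
  rewrite ge0_integralZl//; last 2 first.
  - apply/measurable_EFinP; apply: (measurableT_comp (measurable_powR _)).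
    exact: measurableT_comp.
  - by rewrite lee_fin powR_ge0.
  rewrite EFinM; apply: lee_wpmul2l; first by rewrite lee_fin powR_ge0.
  apply: (brownian_version_moment ipP WP h1) => //; first exact: clamp_ge0.
  exact: clamp_increment.
rewrite indicE (negbTE tD) mulr0 integral0_eq// => w _.
have -> : conv_coef i (t, w) = 0; last by rewrite normr0 powR0// gt_eqF.
rewrite /conv_coef/=; apply/eqP; rewrite mulf_eq0 subr_eq0; apply/orP; right.
suff -> : clamp i t = clamp i (t - delta) by [].
move: tD; rewrite mem_setE/= in_itv/= negb_and -!ltNge -leNgt => /orP[t0|tn].
  have ti : t <= i%:R by rewrite (le_trans t0).
  by rewrite !clamp_small// (le_trans _ ti)// gerBl ltW.
have it : i.+1%:R <= t - delta.
  by rewrite lerBrDr (le_trans _ (ltW tn))// lerD2r ler_nat.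
by rewrite !clamp_large// (le_trans it)// gerBl ltW.
Qed.

Lemma LpX_conv_process (r : R) n j : 0 < r -> LpX P N r (conv_process n j).
Proof.
move=> r0; apply: Lp_space_column => // [i|i i_n]; first exact: measurable_conv_coef.
have mr : measurable_fun [set: measurableTypeR R * Omega]
    (fun z => (`|conv_coef i z| `^ r)%:E).
  apply/measurable_EFinP; apply: (measurableT_comp (measurable_powR _)).
  by apply: measurableT_comp => //; exact: measurable_conv_coef.
rewrite integral_leb_plus_prod//.
apply: (@le_lt_trans _ _ (\int[leb_plus]_t
   ((c `^ r * gauss_moment_bound r 3) * \1_(`]0%R, n%:R + delta]) t)%:E)%E).
  apply: le_integral_nonmeasurable => t; last exact: conv_coef_moment.
  by apply: integral_ge0 => w _; rewrite lee_fin powR_ge0.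
rewrite integral_indic_cst//; last by rewrite !mulr_ge0 ?powR_ge0 ?sqrtr_ge0.
by rewrite leb_plus_itvoc ?addr_ge0 ?(ltW delta0)// -EFinM ltry.
Qed.

Lemma Lp_space_conv_process (t r : R) n j : 0 < r ->
  Lp_space N P r (fun w => conv_process n j (t, w)).
Proof.
move=> r0; apply: Lp_space_column => // [i|i i_n].
  exact: (measurableT_comp (measurable_conv_coef i)
    (measurable_pair1 (t : measurableTypeR R))).
by apply: le_lt_trans (conv_coef_moment t r0 i_n) _; exact: ltry.
Qed.

(** For fixed [t] the integrand of the convolution is again a step process, so
    that its stochastic integral is given by a constant approximating sequence. *)
Lemma scaled_box_step_process t n j :
  (fun z => scaled_box (t - z.1) *: step_process ip (cell_steps n j) z) =
  step_process ip (rank_one_steps h n j c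
    (fun i => clamp i (t - delta)) (fun i => clamp i t))
  :> (R * Omega -> H -> seq2 R).
Proof.
rewrite /cell_steps !step_process_rank_one_steps; apply/funext => z.
apply/funext => g; rewrite /rank_one.
rewrite (_ : (_ *: _) g = scaled_box (t - z.1) *: (ip g h *:
  column n j (fun i => 1 * \1_(`]i%:R, i.+1%:R]) z.1)))//.
rewrite !scalerA mulrC -scalerA; congr (_ *: _).
apply/funext => i'; apply/funext => j'.
rewrite (_ : (_ *: column n j _) i' j' = scaled_box (t - z.1) * column n j
  (fun i => 1 * \1_(`]i%:R, i.+1%:R]) z.1) i' j')//.
rewrite /column; case: ifP => _; last by rewrite mulr0.
by rewrite indic_clamp mul1r /scaled_box mulrA.
Qed.

Lemma stochastic_integral_conv_process t n j : 0 <= t ->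
  stochastic_integral ip P N F W t
    (fun z => scaled_box (t - z.1) *: step_process ip (cell_steps n j) z)
    (fun w => conv_process n j (t, w)).
Proof.
move=> t0; rewrite scaled_box_step_process.
set G := rank_one_steps _ _ _ _ _ _.
have le_cl i : clamp i (t - delta) <= clamp i t.
  by apply: le_clamp; rewrite gerBl ltW.
split; last (exists (fun=> G); split).
- rewrite /G step_process_rank_one_steps.
  apply: (@Lp_space_rank_one_column _ _ _ _ _ q11 q21 _ h1 _
    (measurableTypeR R * Omega)%type _ 2 c
    (`]0, n%:R]%classic `*` setT) n j
    (fun i z => c * \1_(`]clamp i (t - delta), clamp i t]) z.1)) => //.
  + by apply: measurableX => //; exact: measurable_itv.
  + by apply: le_lt_trans (leb_on_cylinder P _ (ler0n R n)) _; exact: ltry.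
  + move=> i; apply: (finitely_valued_comp (fun x => c * x)).
    apply: (@finitely_valued_precomp _ _ (measurableTypeR R * Omega)%type
      (measurableTypeR R) _ fst) => //.
    by apply: finitely_valued_indic; exact: measurable_itv.
  + move=> i z; rewrite normrM (ger0_norm c0) indicE.
    by case: (_ \in _); rewrite ?normr1 ?normr0 ?mulr1 ?mulr0.
  + move=> i z i_n zD; rewrite indicE memNset ?mulr0//= in_itv/= => /andP[z1 z2].
    apply: zD; split => //=; rewrite in_itv/=.
    rewrite (le_lt_trans (clamp_ge0 _ _) z1)/= (le_trans z2)//.
    by rewrite (le_trans (clamp_le _ _))// ler_nat.
- exact: Lp_space_conv_process.
- by move=> m; apply: adapted_rank_one_steps => // i _; exact: clamp_ge0.
- under eq_fun do rewrite subrr.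
  rewrite Lp_norm_ae0//; first exact: cvg_cst.
  by apply/nearW => z; exact: (gamma_norm0 q11 q21 h1).
- rewrite Lp_norm_ae0//; first exact: cvg_cst.
  rewrite step_integral_rank_one_steps; last by move=> i _; exact: clamp_le_of_lt.
  have inc i : {ae P, forall w, Bv (clamp i t, w) - Bv (clamp i (t - delta), w) =
       W (step_vector h (clamp i (t - delta)) (clamp i t)) w}.
    by apply: (brownian_version_increment ipP WP h1) => //; exact: clamp_ge0.
  have /ae_foralln := inc; apply: filterS => w incw.
  rewrite (_ : (_ - _) w = 0) ?lplq_norm0 ?(lt_le_trans ltr01)//.
  apply/eqP; rewrite subr_eq0; apply/eqP.
  congr column; apply/funext => i; rewrite /conv_coef/= incw.
  case: ltP => // le2; rewrite -incw.
  rewrite (_ : clamp i t = clamp i (t - delta)) ?subrr ?mulr0//.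
  by apply/eqP; rewrite eq_le le2 le_cl.
Qed.

(** The data are step processes, so that the closure of the graph is reached by
    constant sequences. *)
Lemma stoch_conv_cell_steps (r : R) n j : 0 < r ->
  stoch_conv ip P N F W scaled_box r (step_process ip (cell_steps n j))
    (conv_process n j).
Proof.
move=> r0; have LY := LpX_conv_process n j r0.
have adG : adapted_step N F (cell_steps n j) by apply: adapted_rank_one_steps.
have appr : approximates ip P N F r (fun=> cell_steps n j)
    (step_process ip (cell_steps n j)).
  split=> // ; under eq_fun do rewrite subrr.
  rewrite /LpF_norm Lp_norm_ae0//; first exact: cvg_cst.
  by apply/nearW => z; exact: (gamma_norm0 q11 q21 h1).
split => //.
- split; last by exists (fun=> cell_steps n j).
  rewrite /cell_steps step_process_rank_one_steps.
  apply: (@Lp_space_rank_one_column _ _ _ _ _ q11 q21 _ h1 _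
    (measurableTypeR R * Omega)%type _ r 1
    (`]0, n%:R]%classic `*` setT) n j
    (fun i z => 1 * \1_(`]i%:R, i.+1%:R]) z.1)) => //.
  + by apply: measurableX => //; exact: measurable_itv.
  + by apply: le_lt_trans (leb_on_cylinder P _ (ler0n R n)) _; exact: ltry.
  + move=> i; apply: (finitely_valued_comp (fun x => 1 * x)).
    apply: (@finitely_valued_precomp _ _ (measurableTypeR R * Omega)%type
      (measurableTypeR R) _ fst) => //.
    by apply: finitely_valued_indic; exact: measurable_itv.
  + move=> i z; rewrite mul1r indicE.
    by case: (_ \in _); rewrite ?normr1 ?normr0.
  + move=> i z i_n zD; rewrite indicE memNset ?mulr0//= in_itv/= => /andP[z1 z2].
    apply: zD; split => //=; rewrite in_itv/=.
    by rewrite (le_lt_trans _ z1)//= (le_trans z2)// ler_nat.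
- exists (fun=> cell_steps n j), (fun=> conv_process n j); split => //.
    move=> _; split => //.
    (* Negative times are negligible for [leb_plus]. *)
    exists `]-oo, 0[%classic; split; first exact: measurable_itv.
      rewrite /leb_plus /leb_on /= /mrestr (_ : _ `&` _ = set0) ?measure0//.
      apply/seteqP; split => t //= [] ; rewrite !in_itv/= andbT => t0.
      by rewrite leNgt t0.
    move=> t /= nt; rewrite in_itv/= ltNge; apply/negP => t0; apply: nt.
    exact: stochastic_integral_conv_process.
  under eq_fun do rewrite subrr.
  rewrite /LpX_norm Lp_norm_ae0//; first exact: cvg_cst.
  by apply/nearW => z; rewrite lplq_norm0// (lt_le_trans ltr01).
Qed.

End stochastic_convolution.

(** * Failure of R-boundedness *)

Section rademacher.
Context {R : realType}.

Lemma card_signs n : #|{: {ffun 'I_n -> bool}}| = (2 ^ n)%N.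
Proof. by rewrite card_ffun card_bool card_ord. Qed.

Lemma rademacherE_cst n (c : R) :
  rademacherE (fun _ : 'I_n -> R => c%:E) = c%:E.
Proof.
rewrite /rademacherE sumEFin sumr_const card_signs -EFinM -[c *+ _]mulr_natl mulrA natrX.
by rewrite mulVf ?mul1r// expf_neq0.
Qed.

Lemma le_rademacherE n (f g : ('I_n -> R) -> \bar R) :
  (forall r, (forall i, `|r i| = 1) -> (f r <= g r)%E) ->
  (rademacherE f <= rademacherE g)%E.
Proof.
move=> fg; apply: lee_wpmul2l; first by rewrite lee_fin invr_ge0 exprn_ge0.
by apply: lee_sum => e _; apply: fg => i; rewrite normr_sign.
Qed.

End rademacher.

Section lower_bound.
Context {R : realType} {d} {T : measurableType d} (mu : {measure set T -> \bar R}).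

(** A substitute for Jensen's inequality that loses a factor 2 in the mean:
    with [q = p / 2 > 1] one has [a <= A + A ^ (1 - q) * a ^ q], and the first
    term accounts for at most half of the integral of [a]. *)
Lemma Lnorm_ge_mean (p A m : R) (D : set T) (f : T -> \bar R) (a : T -> R) :
  2 < p -> 0 < A -> measurable D -> mu D = m%:E -> 0 <= m ->
  measurable_fun setT a -> (forall z, 0 <= a z) -> (forall z, ~ D z -> a z = 0) ->
  (forall z, 0 <= f z)%E -> (forall z, (a z)%:E <= f z `^ 2)%E ->
  ((2 * A * m)%:E <= \int[mu]_z (a z)%:E)%E ->
  ((A `^ 2^-1 * m `^ p^-1)%:E <= 'N[mu]_(p%:E)[f])%E.
Proof.
move=> p2 A0 mD muD m0 ma a0 aD f0 af Ia.
have p0 : 0 < p by lra.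
pose q := p / 2; have q1 : 1 < q by rewrite /q; lra.
have q0 : 0 < q by lra.
have qp : 2^-1 = q * p^-1 by rewrite /q mulrAC mulfV ?mul1r// gt_eqF.
have -> : A `^ 2^-1 * m `^ p^-1 = (A `^ q * m) `^ p^-1.
  by rewrite powRM ?powR_ge0// -powRrM qp.
rewrite unlock -poweR_EFin; apply: gt0_ler_poweR; rewrite ?invr_ge0 ?(ltW p0)//.
- by rewrite in_itv/= leey andbT lee_fin mulr_ge0 ?powR_ge0.
- by rewrite in_itv/= leey andbT integral_ge0// => x _; exact: poweR_ge0.
apply: (@le_trans _ _ (\int[mu]_z (a z `^ q)%:E)%E); last first.
  apply: le_integral_nonmeasurable => z; first by rewrite lee_fin powR_ge0.
  have pE : p = 2 * q by rewrite /q mulrCA mulfV ?mulr1.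
  rewrite gee0_abs// [X in (_ <= _ `^ X)%E]pE (poweRrM _ 2 q).
  rewrite -poweR_EFin. apply: gt0_ler_poweR; rewrite ?(ltW q0)//.
  - by rewrite in_itv/= leey andbT lee_fin.
  - by rewrite in_itv/= leey andbT poweR_ge0.
have maq : measurable_fun setT (fun z => (a z `^ q)%:E).
  by apply/measurable_EFinP; apply: (measurableT_comp (measurable_powR _)).
have split_a : (\int[mu]_z (a z)%:E <=
    (A * m)%:E + (A `^ (1 - q))%:E * \int[mu]_z (a z `^ q)%:E)%E.
  rewrite EFinM -muD -integral_indic_cst ?(ltW A0)//.
  rewrite -ge0_integralZl//; last 2 first.
  - by move=> z _; rewrite lee_fin powR_ge0.
  - by rewrite lee_fin powR_ge0.
  rewrite -ge0_integralD//; last 4 first.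
  - by move=> z _; rewrite lee_fin mulr_ge0 ?(ltW A0).
  - by apply/measurable_EFinP; apply: measurable_funM => //; exact: measurable_indic.
  - by move=> z _; rewrite -EFinM lee_fin mulr_ge0 ?powR_ge0.
  - by apply: emeasurable_funM.
  apply: le_integral_nonmeasurable => z; first by rewrite lee_fin.
  rewrite -EFinM -EFinD lee_fin.
  have [zD|zD] := boolP (z \in D); last first.
    rewrite aD ?addr_ge0 ?mulr_ge0 ?powR_ge0 ?(ltW A0)//.
    by move=> /mem_set; rewrite (negbTE zD).
  rewrite indicE zD mulr1; have [aA|Aa] := leP (a z) A.
    by rewrite (le_trans aA)// lerDl mulr_ge0 ?powR_ge0.
  apply: (@le_trans _ _ (A `^ (1 - q) * a z `^ q)); last by rewrite lerDr ltW.
  have az0 : 0 < a z by exact: lt_trans Aa.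
  have aE : a z = a z `^ (1 - q) * a z `^ q.
    by rewrite -powRD ?subrK ?powRr1// (gt_eqF az0) implybT.
  rewrite {1}aE.
  apply: ler_wpM2r; first exact: powR_ge0.
  rewrite -(opprB q 1) !powRN lef_pV2 ?posrE ?powR_gt0//.
  by apply: ge0_ler_powR; rewrite ?nnegrE ?(ltW A0) ?(ltW az0) ?(ltW Aa)// subr_ge0 ltW.
have := le_trans Ia split_a; case: (\int[mu]_z (a z `^ q)%:E)%E => [I||].
- rewrite -EFinM -EFinD !lee_fin => h.
  have h' : A * m <= A `^ (1 - q) * I by lra.
  have -> : A `^ q = A / A `^ (1 - q).
    rewrite -{2}(powRr1 (ltW A0)) -powRB; first by congr (_ `^ _); lra.
    by rewrite (gt_eqF A0) implybT.
  by rewrite mulrAC ler_pdivrMr ?powR_gt0// [I * _]mulrC.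
- by rewrite leey.
- rewrite mulr_infty gtr0_sg ?powR_gt0// mul1e.
  by rewrite addeNy.
Qed.

End lower_bound.

Section test_processes.
Context {R : realType} {H : completeNormedModType R} (ip : H -> H -> R).
Context {dO} {Omega : measurableType dO} (P : probability Omega R).
Variables (F : R -> set (set Omega)) (W : (R -> H) -> Omega -> R).
Hypothesis ipP : is_inner_product ip.
Hypothesis FP : is_filtration F.
Hypothesis WP : is_cylindrical_BM ip P F W.
Variables (h : H) (h1 : ip h h = 1).
Local Notation N := (@lplq_norm R 2 4).
Local Notation K := (gauss_moment_bound (2 : R) 1 `^ 2^-1).

Let le12 : 1 <= 2 :> R. Proof. by rewrite ler1n. Qed.
Let le14 : 1 <= 4 :> R. Proof. by rewrite ler1n. Qed.

Definition root_box (delta : R) : R -> R := scaled_box (Num.sqrt (2 * delta)^-1) delta.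

Lemma root_box_sqr (delta : R) : 0 < delta ->
  (fun t => root_box delta t ^+ 2) = box_kernel delta.
Proof.
move=> d0; apply/funext => t; rewrite /root_box /scaled_box /box_kernel exprMn.
rewrite sqr_sqrtr ?invr_ge0 ?mulr_ge0 ?(ltW d0)//; congr (_ * _).
by rewrite indicE; case: (_ \in _); rewrite ?expr1n ?expr0n.
Qed.

Lemma sqrt_Ktilde_plus_root_box (delta : R) : 0 < delta ->
  sqrt_Ktilde_plus (root_box delta).
Proof.
move=> d0; split.
- move=> t t0; rewrite /root_box /scaled_box indicE memNset ?mulr0//=.
  by rewrite in_itv/= leNgt t0.
- apply/andP; split; rewrite inE /=.
    by apply: measurable_funM => //; exact: measurable_indic.
  rewrite /finite_norm.
  apply: (@le_lt_trans _ _ ((Num.sqrt (2 * delta)^-1)%:E *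
      lebesgue_measure (`[0%R, delta[%classic : set (measurableTypeR R)) `^ 2^-1)%E).
    apply: Lnorm_le_on => //=.
    + move=> t td; rewrite /root_box /scaled_box indicE mem_set// mulr1.
      by rewrite ger0_norm// sqrtr_ge0.
    + by move=> t td; rewrite /root_box /scaled_box indicE memNset// mulr0.
  by rewrite lebesgue_measure_itv/= lte_fin d0 -EFinD poweR_EFin -EFinM ltry.
- by rewrite root_box_sqr//; exact: Ktilde_box_kernel.
Qed.

Variables (J : nat).
Let n : nat := (2 * 2 ^ J)%N.
Let scale (j : nat) : R := 2 ^+ j.+1.

Let scale_gt0 j : 0 < scale j. Proof. by rewrite exprn_gt0. Qed.

Definition inputs (j : 'I_J) : R * Omega -> H -> seq2 R :=
  step_process ip (cell_steps h n j).

Definition output_coef (j i : nat) (z : R * Omega) : R :=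
  conv_coef W h (Num.sqrt (2 * scale j)^-1) (scale j) i z.

Definition outputs (j : 'I_J) : R * Omega -> seq2 R :=
  conv_process W h (Num.sqrt (2 * scale j)^-1) (scale j) n j.

Lemma stoch_conv_inputs (p : R) (j : 'I_J) : 0 < p ->
  stoch_conv ip P N F W (root_box (scale j)) p (inputs j) (outputs j).
Proof. by move=> p0; apply: stoch_conv_cell_steps => //; exact: sqrtr_ge0. Qed.

(** The sum is the rank one operator with vector [s z]; whatever the signs, its
    row at the active cell consists of [J] entries of modulus 1. *)
Lemma inputs_norm_le (p : R) (r : 'I_J -> R) : 0 < p -> (forall j, `|r j| = 1) ->
  (LpF_norm ip P N p (\sum_(j < J) r j *: inputs j)%R
    <= (K * J%:R `^ 4^-1 * n%:R `^ p^-1)%:E)%E.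
Proof.
move=> p0 r1.
pose s (z : R * Omega) : seq2 R :=
  \sum_(j < J) column n j (fun i => r j * (1 * \1_(`]i%:R, i.+1%:R]) z.1)).
have sumE : \sum_(j < J) r j *: inputs j = fun z => rank_one ip h (s z).
  apply/funext => z; apply/funext => g.
  rewrite (_ : (\sum_(j < J) _) z g = \sum_(j < J) r j *: inputs j z g); last first.
    by elim/big_rec2: _ => // k y1 y2 _ <-.
  rewrite /rank_one /s scaler_sumr; apply: eq_bigr => j _.
  rewrite /inputs /cell_steps step_process_rank_one_steps /rank_one.
  rewrite scalerA mulrC -scalerA; congr (_ *: _).
  apply/funext => i'; apply/funext => j'.
  rewrite (_ : (r j *: _) i' j' = r j * column n j
    (fun i => 1 * \1_(`]i%:R, i.+1%:R]) z.1) i' j')//.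
  by rewrite /column; case: ifP => // _; rewrite mulr0.
have sumcE z i j : (\sum_(k < J) column n k
    (fun i => r k * (1 * \1_(`]i%:R, i.+1%:R]) z.1))) i j =
    \sum_(k < J) column n k (fun i => r k * (1 * \1_(`]i%:R, i.+1%:R]) z.1)) i j.
  by elim/big_rec2: _ => // k y1 y2 _ <-.
have sE z i j : `|s z i j| = ((i < n) && (j < J))%N%:R * \1_(cell i) z.1.
  rewrite /s sumcE; have [jJ|Jj] := ltnP j J; last first.
    by rewrite sum_column_out// normr0 andbF mul0r.
  rewrite (sum_column_in _ _ _ (Ordinal jJ)) andbT.
  by case: ifP; rewrite ?normr0 ?mul0r// normrM r1 !mul1r ger0_norm.
have s_supp z : finite_support (s z).
  exists n, J => i j ij; apply/eqP; rewrite -normr_eq0 sE.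
  by rewrite (negbTE ij) mul0r.
have Ns z : N (s z) = if 0 < z.1 <= n%:R then (J%:R `^ 4^-1)%:E else 0%E.
  by apply: lplq_norm_cell => // i j; exact: sE.
pose D0 : set (measurableTypeR R * Omega) := `]0, n%:R]%classic `*` setT.
have mD0 : ((leb_plus \x P) D0 = n%:R%:E)%E.
  by rewrite leb_plus_cylinder// subr0.
rewrite sumE EFinM -poweR_EFin -mD0.
have gle z : (gamma_norm ip N (rank_one ip h (s z)) <= K%:E * N (s z))%E.
  exact: gamma_norm_rank_one.
apply: Lnorm_le_on => //=.
- by rewrite mulr_ge0 ?powR_ge0.
- by apply: measurableX => //; exact: measurable_itv.
- move=> z [/=]; rewrite in_itv/= => z1 _.
  rewrite gee0_abs ?gamma_norm_ge0// (le_trans (gle z))// Ns z1 EFinM//.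
- move=> z zD; apply/eqP; rewrite eq_le gamma_norm_ge0 andbT (le_trans (gle z))//.
  rewrite Ns; case: ifP => [z1|_]; last by rewrite mule0.
  by exfalso; apply: zD; split => //=; rewrite in_itv.
Qed.

Lemma dyadicE i j (t : R) : (dyadic t i j)%:R =
  \1_(`]i%:R + 2 ^+ j, i%:R + 2 ^+ j.+1]) t :> R.
Proof.
rewrite indicE mem_setE/= in_itv/= /dyadic; congr (nat_of_bool (_ && _))%:R.
  by rewrite ltrBrDl.
by rewrite lerBlDl.
Qed.

(** A measurable lower bound of the squared norm of the output whose mean is
    explicit: the square of one entry per row, which is the square of the norm
    in l^2(l^4) of what the selection keeps. *)
Definition selected_energy (z : R * Omega) : R :=
  \1_(`](2 ^ J)%:R, n%:R]) z.1 *
  \sum_(i < n) \sum_(j < J) (dyadic z.1 i j)%:R * output_coef j i z ^+ 2.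

Lemma measurable_output_coef j i :
  measurable_fun [set: measurableTypeR R * Omega] (output_coef j i).
Proof. exact: measurable_conv_coef WP _ _ _ _. Qed.

Lemma measurable_selected_energy :
  measurable_fun [set: measurableTypeR R * Omega] selected_energy.
Proof.
have mfst (A : set (measurableTypeR R)) : measurable A ->
    measurable_fun [set: measurableTypeR R * Omega] (fun z => \1_A z.1 : R).
  move=> mA; exact: (measurableT_comp (measurable_indic mA)
    (@measurable_fst _ _ (measurableTypeR R) Omega)).
apply: measurable_funM; first by apply: mfst; exact: measurable_itv.
apply: measurable_sum => i; apply: measurable_sum => j.
apply: measurable_funM; last by apply: measurable_funX; exact: measurable_output_coef.
under eq_fun do rewrite dyadicE.
by apply: mfst; exact: measurable_itv.
Qed.

(** The cell lies entirely in the window, so that the clamped times are its two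
    end points. *)
Lemma output_coef_variance (t : R) i j : dyadic t i j ->
  (\int[P]_w (output_coef j i (t, w) ^+ 2)%:E = ((2 ^+ j.+2)^-1)%:E)%E.
Proof.
move=> /andP[ti it]; have := exprn_ege1 j le12 => e1.
have ci : clamp i t = i.+1%:R by apply: clamp_large; rewrite -natr1; lra.
have ci' : clamp i (t - scale j) = i%:R by apply: clamp_small; rewrite /scale; lra.
have c0 : 0 <= (2 * scale j)^-1 by rewrite invr_ge0 mulr_ge0// ltW.
rewrite /output_coef /conv_coef/= ci ci'.
under eq_integral => w _ do rewrite exprMn sqr_sqrtr// EFinM.
rewrite ge0_integralZl//; last 2 first.
- apply/measurable_EFinP; apply: measurable_funX.
  exact: (measurable_brownian_version_increment WP h i%:R i.+1%:R).
- by move=> w _; rewrite lee_fin sqr_ge0.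
rewrite (brownian_version_variance ipP WP h1) ?ler_nat//.
by rewrite -natrB// subSnn mule1 /scale -exprS.
Qed.

(** The variances of the kept entries are the numbers summed in [sum_dyadic_ge]. *)
Lemma integral_selected_energy_ge :
  ((2 * (J%:R / 8) * (2 ^ J)%:R)%:E <= \int[leb_plus \x P]_z (selected_energy z)%:E)%E.
Proof.
have energy_ge0 z : 0 <= selected_energy z.
  by rewrite mulr_ge0// sumr_ge0// => i _; rewrite sumr_ge0// => j _; rewrite mulr_ge0// sqr_ge0.
rewrite integral_leb_plus_prod//; last first.
  by apply/measurable_EFinP; exact: measurable_selected_energy.
have -> : (2 * (J%:R / 8) * (2 ^ J)%:R)%:E =
    (\int[leb_plus]_t (J%:R / 4 * \1_(`](2 ^ J)%:R, n%:R]) t)%:E)%E :> \bar R.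
  rewrite integral_indic_cst ?divr_ge0//.
  rewrite leb_plus_itvoc ?ler_nat ?leq_pmull// -natrB ?leq_pmull//.
  rewrite /n mul2n -addnn addnK -EFinM; congr (_%:E); lra.
apply: le_integral_nonmeasurable => t.
  by rewrite lee_fin mulr_ge0// divr_ge0.
have [tD|tD] := boolP (t \in `](2 ^ J)%:R, n%:R]%classic); last first.
  by rewrite indicE (negbTE tD) mulr0 integral_ge0// => w _; rewrite lee_fin.
rewrite indicE tD mulr1.
have mc i j : measurable_fun setT
    (fun w => ((dyadic t i j)%:R * output_coef j i (t, w) ^+ 2)%:E).
  apply/measurable_EFinP; apply: measurable_funM => //; apply: measurable_funX.
  exact: (measurableT_comp (measurable_output_coef j i)
    (measurable_pair1 (t : measurableTypeR R))).
have c0 i j w : (0 <= ((dyadic t i j)%:R * output_coef j i (t, w) ^+ 2)%:E)%E.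
  by rewrite lee_fin mulr_ge0// sqr_ge0.
have -> : (\int[P]_w (selected_energy (t, w))%:E =
    \sum_(i < n) \sum_(j < J) \int[P]_w
      ((dyadic t i j)%:R * output_coef j i (t, w) ^+ 2)%:E)%E.
  rewrite (eq_integral (fun w => \sum_(i < n) \sum_(j < J)
      ((dyadic t i j)%:R * output_coef j i (t, w) ^+ 2)%:E)%E); last first.
    move=> w _; rewrite /selected_energy/= indicE tD mul1r -sumEFin.
    by apply: eq_bigr => i _; rewrite -sumEFin.
  rewrite ge0_integral_sum//; last 2 first.
  - by move=> i; exact: emeasurable_sum.
  - by move=> i w _; exact: sume_ge0.
  by apply: eq_bigr => i _; rewrite ge0_integral_sum.
move: tD; rewrite mem_setE/= in_itv/= => /andP[Mt tn].
apply: (@le_trans _ _ (\sum_(i < n) \sum_(j < J)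
    ((dyadic t i j)%:R * (2 ^+ j.+2)^-1)%:E)%E).
  have := sum_dyadic_ge Mt tn; rewrite -lee_fin -sumEFin.
  by under eq_bigr do rewrite -sumEFin.
apply: lee_sum => i _; apply: lee_sum => j _.
case: (boolP (dyadic t i j)) => [dt|_]; last by rewrite mul0r integral_ge0// => w _; rewrite mul0r.
rewrite mul1r -(output_coef_variance dt) le_eqVlt; apply/orP; left; apply/eqP.
by apply: eq_integral => w _; rewrite mul1r.
Qed.

(** The mean of [selected_energy] over (2 ^ J, 2 ^ (J + 1)] is at least twice
    [J / 8], the factor 2 being the one lost in [Lnorm_ge_mean]. *)
Lemma outputs_norm_ge (p : R) (r : 'I_J -> R) : 2 < p -> (0 < J)%N ->
  (forall j, `|r j| = 1) ->
  (((J%:R / 8) `^ 2^-1 * (2 ^ J)%:R `^ p^-1)%:E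
    <= LpX_norm P N p (\sum_(j < J) r j *: outputs j)%R)%E.
Proof.
move=> p2 J0 r1.
pose D : set (measurableTypeR R * Omega) := `](2 ^ J)%:R, n%:R]%classic `*` setT.
apply: (@Lnorm_ge_mean _ _ _ _ p (J%:R / 8) (2 ^ J)%:R D _ selected_energy) => //.
- by rewrite divr_gt0// ltr0n.
- by apply: measurableX => //; exact: measurable_itv.
- have -> : (2 ^ J)%:R = n%:R - (2 ^ J)%:R :> R.
    by rewrite -natrB ?leq_pmull// /n mul2n -addnn addnK.
  by apply: leb_plus_cylinder; rewrite ?ler_nat ?leq_pmull.
- exact: measurable_selected_energy.
- by move=> z; rewrite mulr_ge0// sumr_ge0// => i _; rewrite sumr_ge0// => j _; rewrite mulr_ge0// sqr_ge0.
- move=> z zD; rewrite /selected_energy indicE memNset ?mul0r// => z1; exact: zD.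
- by move=> z; exact: lplq_norm_ge0.
- move=> z /=; set y := (\sum_(j < J) r j *: outputs j) z.
  have yE i j : y i j = \sum_(k < J) column n k (fun i => r k * output_coef k i z) i j.
    rewrite /y (_ : (\sum_(k < J) _) z i j = \sum_(k < J) r k * outputs k z i j).
      apply: eq_bigr => k _; rewrite /outputs /conv_process /column.
      by case: ifP => // _; rewrite mulr0.
    by elim/big_rec2: _ => // k y1 y2 _ <-.
  apply: (@le_trans _ _ (\sum_(i < n) \sum_(j < J)
      (dyadic z.1 i j)%:R * `|y i j| `^ 2)%:E); last first.
    apply: lplq_norm_ge_selection => //; last by move=> i j j'; exact: dyadic_inj.
    move=> i j ij; rewrite yE; have [jJ|Jj] := ltnP j J; last first.
      by rewrite sum_column_out.
    rewrite (sum_column_in _ _ _ (Ordinal jJ)) ifF//.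
    by move: ij; rewrite jJ andbT => /negbTE.
  rewrite lee_fin /selected_energy.
  have S0 : 0 <= \sum_(i < n) \sum_(j < J) (dyadic z.1 i j)%:R * output_coef j i z ^+ 2.
    by rewrite sumr_ge0// => i _; rewrite sumr_ge0// => j _; rewrite mulr_ge0// sqr_ge0.
  apply: (@le_trans _ _ (\sum_(i < n) \sum_(j < J)
      (dyadic z.1 i j)%:R * output_coef j i z ^+ 2)).
    by rewrite indicE; case: (_ \in _); rewrite ?mul1r ?mul0r.
  apply: ler_sum => i _; apply: ler_sum => j _.
  rewrite yE sum_column_in ltn_ord powR_mulrn// normrM r1 mul1r.
  by rewrite real_normK ?num_real.
exact: integral_selected_energy_ge.
Qed.

End test_processes.

Section failure_of_R_boundedness.
Context {R : realType} {H : completeNormedModType R} (ip : H -> H -> R).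
Context {dO} {Omega : measurableType dO} (P : probability Omega R).
Variables (F : R -> set (set Omega)) (W : (R -> H) -> Omega -> R).

Lemma exists_unit_vector : is_inner_product ip -> (exists h : H, h != 0) ->
  exists h, ip h h = 1.
Proof.
move=> [_ _ ipE] [h h0]; have nh : `|h| != 0 by rewrite normr_eq0.
exists (`|h|^-1 *: h); rewrite -ipE normrZ ger0_norm ?invr_ge0//.
by rewrite mulVf// expr1n.
Qed.

Lemma not_R_bounded_stoch_conv (p : R) : 2 < p ->
  is_inner_product ip -> (exists h : H, h != 0) ->
  is_filtration F -> is_cylindrical_BM ip P F W ->
  ~ R_bounded (LpF_norm ip P (lplq_norm 2 4) p) (LpX_norm P (lplq_norm 2 4) p)
      [set S | exists2 k, sqrt_Ktilde_plus k &
               S = stoch_conv ip P (lplq_norm 2 4) F W k p].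
Proof.
move=> p2 ipP /(exists_unit_vector ipP)[h h1] FP WP [C C0 bdd].
have p0 : 0 < p by lra.
set K := gauss_moment_bound (2 : R) 1 `^ 2^-1.
have K0 : 0 <= K by exact: powR_ge0.
(* [J] is chosen such that [sqrt J > 16 * (C * K) ^ 2]: the factor 16 makes up
   for the 8 in the lower bound and for [2 ^ (2 / p) <= 2]. *)
set B := 16 * (C * K) ^+ 2; have B0 : 0 <= B by rewrite mulr_ge0// sqr_ge0.
have [J BJ] : exists J : nat, B ^+ 2 < J%:R.
  by exists (Num.truncn (B ^+ 2)).+1; exact: truncnS_gt.
have JR0 : 0 < J%:R :> R by rewrite (le_lt_trans _ BJ)// sqr_ge0.
have J0 : (0 < J)%N by rewrite -(ltr_nat R).
pose T (j : 'I_J) := stoch_conv ip P (lplq_norm 2 4) F W (root_box (2 ^+ j.+1)) p.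
have TP j : exists2 k, sqrt_Ktilde_plus k &
    T j = stoch_conv ip P (lplq_norm 2 4) F W k p.
  exists (root_box (2 ^+ j.+1)) => //.
  by apply: sqrt_Ktilde_plus_root_box; rewrite exprn_gt0.
have := bdd J T (inputs ip h (J := J)) (outputs W h (J := J)) TP
  (fun j => stoch_conv_inputs ipP FP WP h1 j p0).
set EW := rademacherE _; set EV := rademacherE _.
set a := (J%:R / 8) `^ 2^-1 * (2 ^ J)%:R `^ p^-1.
set b := K * J%:R `^ 4^-1 * (2 * 2 ^ J)%:R `^ p^-1.
have a0 : 0 <= a by rewrite mulr_ge0 ?powR_ge0.
have b0 : 0 <= b by rewrite !mulr_ge0 ?powR_ge0.
have lower : ((a ^+ 2)%:E <= EW)%E.
  rewrite -(rademacherE_cst J (a ^+ 2)); apply: le_rademacherE => r r1.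
  have := outputs_norm_ge ipP WP h1 p2 J0 r1; rewrite -/a => ha.
  by rewrite expr2 EFinM expe2; apply: lee_pmul => //; rewrite lee_fin.
have upper : (EV <= (b ^+ 2)%:E)%E.
  rewrite -(rademacherE_cst J (b ^+ 2)); apply: le_rademacherE => r r1.
  have := inputs_norm_le P h1 p0 r1; rewrite -/K -/b => hb.
  rewrite expr2 EFinM expe2; apply: lee_pmul => //; exact: Lnorm_ge0.
move=> /(le_trans lower) /le_trans.
move=> /(_ _ (lee_wpmul2l (_ : (0 <= (C ^+ 2)%:E)%E) upper)).
rewrite lee_fin sqr_ge0 => /(_ isT); rewrite -EFinM lee_fin; apply/negP.
have sqr_half x : 0 <= x -> (x `^ 2^-1) ^+ 2 = x :> R.
  by move=> x0; rewrite powR12_sqrt// sqr_sqrtr.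
pose m := ((2 ^ J)%:R `^ p^-1 : R) ^+ 2; have m0 : 0 < m.
  by rewrite exprn_gt0// powR_gt0// ltr0n expn_gt0.
pose s := (J%:R `^ 4^-1 : R) ^+ 2; have sE : s ^+ 2 = J%:R.
  by rewrite /s -exprM -powR_mulrn ?powR_ge0// -powRrM mulVf// powRr1.
have s0 : 0 < s by rewrite exprn_gt0// powR_gt0.
pose t := (2 `^ p^-1 : R) ^+ 2; have t2 : t <= 2.
  rewrite -[leRHS](sqr_half 2)// lerXn2r ?nnegrE ?powR_ge0//.
  by apply: ler_powR; rewrite ?ler1n// lef_pV2 ?posrE// ltW.
have aE : a ^+ 2 = s ^+ 2 / 8 * m.
  by rewrite sE -(sqr_half (J%:R / 8)) ?divr_ge0// -exprMn.
have bE : b ^+ 2 = K ^+ 2 * s * t * m.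
  by rewrite /b natrM powRM// /s /t /m -!exprMn !mulrA.
rewrite -ltNge aE bE.
have -> : C ^+ 2 * (K ^+ 2 * s * t * m) = C ^+ 2 * K ^+ 2 * s * t * m by lra.
rewrite ltr_pM2r//.
have Bs : B < s.
  by rewrite -(ltr_pXn2r (_ : 0 < 2)%N) ?nnegrE ?(ltW s0)// sE.
have BE : B = 16 * (C ^+ 2 * K ^+ 2) by rewrite /B exprMn.
have c0 : 0 <= C ^+ 2 * K ^+ 2 by rewrite mulr_ge0// sqr_ge0.
move: Bs c0; rewrite BE; move: (C ^+ 2 * K ^+ 2) => c Bs c0.
apply: (@le_lt_trans _ _ (c * s * 2)).
  by apply: ler_wpM2l => //; rewrite mulr_ge0// ltW.
nra.
Qed.

End failure_of_R_boundedness.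

Theorem theorem8p2 (R : realType) :
  (forall p : R, 1 < p ->
     ~ ell1_bounded
         (Lp_space (lplq_norm 1 2) leb_plus p)
         (Lp_norm (lplq_norm 1 2) leb_plus p)
         abs_fun
         [set T | exists2 k, Ktilde_plus k & T = Tconv k]) /\
  (forall (p : R) (H : completeNormedModType R) (ip : H -> H -> R)
     (d : measure_display) (Omega : measurableType d)
     (P : probability Omega R)
     (F : R -> set (set Omega)) (W : (R -> H) -> Omega -> R),
     2 < p ->
     is_inner_product ip -> (exists h : H, h != 0) ->
     is_filtration F -> is_cylindrical_BM ip P F W ->
     ~ R_bounded
         (LpF_norm ip P (lplq_norm 2 4) p)
         (LpX_norm P (lplq_norm 2 4) p)
         [set S | exists2 k, sqrt_Ktilde_plus k &
                  S = stoch_conv ip P (lplq_norm 2 4) F W k p]).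
Proof.
split=> [p p1|p H ip d Omega P F W p2 ipP Hne FP WP].
  exact: not_ell1_bounded_Ktilde.
exact: not_R_bounded_stoch_conv FP WP.
Qed.
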